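(* Let $n\ge2$ and let $\mathcal C\subseteq\mathcal D(\mathbb R_+)$ be PAT-closed. Then the following are equivalent: 1. $\mathcal C$ is universally locally FW-stable. 2. $\mathcal C$ is universally globally FW-stable. 3. $\mathcal C\subseteq Q_n(\mathbb R_+)$. Consequently, $Q_n(\mathbb R_+)$ is the unique largest (with respect to inclusion) PAT-closed class with either universal FW-stability property: $Q_n(\mathbb R_+)$ is PAT-closed, is universally locally FW-stable and universally globally FW-stable, and contains every PAT-closed class $\mathcal C\subseteq\mathcal D(\mathbb R_+)$ having either of the two properties.
   Context: Cost classes. $\mathbb R_+=[0,\infty)$. $\mathcal D(\mathbb R_+)$ is the set of $f\in C^2(\mathbb R_+)$ (real-valued) with $f'(x)\ge0$ and $2f'(x)+xf''(x)\ge0$ for all $x\in\mathbb R_+$. For $n\ge2$, $\gamma_n:=\frac{2(n+1)}{n-1}$ and $Q_n(\mathbb R_+):=\{f\in\mathcal D(\mathbb R_+):\gamma_nf'(x)-xf''(x)\ge0\ \forall x\in\mathbb R_+\}$. A class $\mathcal C\subseteq\mathcal D(\mathbb R_+)$ is PAT-closed if for every $f\in\mathcal C$, every $\alpha>0$ and every $b\in\mathbb R$, also $\alpha f+b\in\mathcal C$. Games. An $n$-player atomic splittable congestion game is a tuple $(N,E,(K_i)_{i\in N},(c_e)_{e\in E})$ with $N=\{1,\dots,n\}$, a finite resource set $E$, nonempty convex compact strategy sets $K_i\subset\mathbb R_+^E$, and cost functions $c_e\in\mathcal D(\mathbb R_+)$. Put $K:=\prod_iK_i$ and $\bar x_e:=\sum_{i\in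 N}x_{i,e}$ for $x\in K$. The marginal cost operator is $F_{i,e}(x):=c_e(\bar x_e)+x_{i,e}c_e'(\bar x_e)$. Dynamics. For $\eta>0$, $\beta^\eta(z)=(\beta_i^\eta(z_i))_{i\in N}$ with $\beta_i^\eta(z_i):=\arg\min_{y_i\in K_i}\{\langle z_i,y_i\rangle+\frac{\eta}{2}\|y_i\|^2\}$. The Euclidean-regularized Frank--Wolfe (FW) dynamics are $\dot x=\beta^\eta(F(x))-x$ on $K$. A regularized equilibrium is a rest point, i.e. $x^*\in K$ with $x^*=\beta^\eta(F(x^* ))$. Stability. A rest point $x^*$ is locally Lyapunov stable if for every neighbourhood $U$ of $x^*$ relative to $K$ there is a neighbourhood $V\subseteq U$ of $x^*$ relative to $K$ such that every solution with $x(0)\in V$ satisfies $x(t)\in U$ for all $t\ge0$. A set $X^*\subseteq K$ is globally asymptotically stable if (i) for every $\varepsilon>0$ there is $\delta>0$ such that every solution with $\operatorname{dist}(x(0),X^* )\le\delta$ satisfies $\operatorname{dist}(x(t),X^* )\le\varepsilon$ for all $t\ge0$, and (ii) for every $x(0)\in K$ the corresponding solution satisfies $\lim_{t\to\infty}\operatorname{dist}(x(t),X^* )=0$, where $\operatorname{dist}(x,X^* )=\inf_{y\in X^*}\|x-y\|$. A PAT-closed class $\mathcal C\subseteq\mathcal D(\mathbb R_+)$ is universally locally FW-stable (for the fixed $n$) if, for every $\eta>0$ and every $n$-player atomic splittable congestion game with resource costs in $\mathcal C$, every regularized equilibrium of the Euclidean-regularized FW dynamics is locally Lyapunov stable. It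 is universally globally FW-stable if, for every $\eta>0$ and every such game, the set of regularized equilibria is globally asymptotically stable. *)

(* Defs.v *)
From HB Require Import structures.
From mathcomp Require Import all_boot all_order all_algebra.
From mathcomp Require Import all_classical all_reals all_analysis.

Set Implicit Arguments.
Unset Strict Implicit.
Unset Printing Implicit Defensive.

Import Order.TTheory GRing.Theory Num.Theory.
Import numFieldNormedType.Exports.

Local Open Scope classical_set_scope.
Local Open Scope ring_scope.

(* Functions on R_+ = [0, +oo[ are represented by total functions on R.  Every
   notion below only looks at their values on R_+; in particular derivatives
   are taken within R_+, hence one-sided at 0. *)

Definition Rplus (R : realType) : set R := [set x | 0 <= x].

Definition diff_quot (R : realType) (V : normedModType R) (f : R -> V) (x : R) :
    R -> V :=
  fun y => (y - x)^-1 *: (f y - f x).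

Definition has_drv (R : realType) (V : normedModType R)
    (f : R -> V) (x : R) (l : V) : Prop :=
  diff_quot f x @ within (@Rplus R) x^' --> l.

(* As for derive1, drv f x is meaningful only where f is differentiable. *)
Definition drv (R : realType) (f : R -> R) (x : R) : R :=
  lim (diff_quot (f : R -> R^o) x @ within (@Rplus R) x^').

Definition drvable (R : realType) (f : R -> R) : Prop :=
  forall x : R, 0 <= x -> has_drv (f : R -> R^o) x (drv f x).

Definition C2_Rplus (R : realType) (f : R -> R) : Prop :=
  [/\ drvable f, drvable (drv f) & {within @Rplus R, continuous (drv (drv f))}].

Definition class_D (R : realType) : set (R -> R) :=
  [set f | C2_Rplus f /\
    forall x : R, 0 <= x -> 0 <= drv f x /\ 0 <= 2 * drv f x + x * drv (drv f) x].

Definition gamma_n (R : realType) (n : nat) : R := 2 * (n%:R + 1) / (n%:R - 1).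

Definition class_Q (R : realType) (n : nat) : set (R -> R) :=
  [set f | class_D f /\
    forall x : R, 0 <= x -> 0 <= gamma_n R n * drv f x - x * drv (drv f) x].

Definition PAT_closed (R : realType) (C : set (R -> R)) : Prop :=
  C `<=` @class_D R /\
  forall f, C f -> forall a b : R, 0 < a -> C (fun x => a * f x + b).

Definition eucl_dot (R : realType) (p q : nat) (x y : 'M[R]_(p, q)) : R :=
  \sum_i \sum_j x i j * y i j.

(* The library norm on matrices is the sup norm. *)
Definition enorm (R : realType) (p q : nat) (x : 'M[R]_(p, q)) : R :=
  Num.sqrt (eucl_dot x x).

(* Extended-real valued, so that the distance to the empty set is +oo. *)
Definition edist_to (R : realType) (p q : nat)
    (x : 'M[R]_(p, q)) (X : set 'M[R]_(p, q)) : \bar R :=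
  ereal_inf [set (enorm (x - y))%:E | y in X].

(* Players are 'I_n and resources 'I_m; a profile is a matrix x with x i e the
   load that player i puts on resource e, and row i x the strategy of i. *)
Record game (R : realType) (n m : nat) := Game {
  strat : 'I_n -> set 'rV[R]_m;
  cost : 'I_m -> R -> R;
  strat_ge0 : forall i y, strat i y -> forall e, 0 <= y ord0 e;
  strat_nonempty : forall i, strat i !=set0;
  strat_convex : forall i, @convex_set R 'rV[R]_m (strat i);
  strat_compact : forall i, compact (strat i);
  cost_class_D : forall e, class_D (cost e)
}.

Definition profiles (R : realType) (n m : nat) (G : game R n m) :
    set 'M[R]_(n, m) :=
  [set x | forall i, strat G i (row i x)].

Definition load (R : realType) (n m : nat) (x : 'M[R]_(n, m)) (e : 'I_m) : R :=
  \sum_i x i e.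

Definition marginal_cost (R : realType) (n m : nat) (G : game R n m)
    (x : 'M[R]_(n, m)) : 'M[R]_(n, m) :=
  \matrix_(i, e)
    (cost G e (load x e) + x i e * drv (cost G e) (load x e)).

Definition argmin (R : realType) (T : Type) (A : set T) (h : T -> R) : set T :=
  [set y | A y /\ forall y', A y' -> h y <= h y'].

(* The argmin below is a singleton, so xget returns its unique element. *)
Definition reg_best_response (R : realType) (n m : nat) (G : game R n m)
    (eta : R) (z : 'M[R]_(n, m)) : 'M[R]_(n, m) :=
  \matrix_(i < n)
    xget 0 (argmin (strat G i)
      (fun y : 'rV[R]_m => eucl_dot (row i z) y + eta / 2 * enorm y ^+ 2)).

Definition FW_field (R : realType) (n m : nat) (G : game R n m) (eta : R)
    (x : 'M[R]_(n, m)) : 'M[R]_(n, m) :=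
  reg_best_response G eta (marginal_cost G x) - x.

Definition FW_solution (R : realType) (n m : nat) (G : game R n m) (eta : R)
    (x : R -> 'M[R]_(n, m)) : Prop :=
  forall t : R, 0 <= t ->
    profiles G (x t) /\ has_drv x t (FW_field G eta (x t)).

Definition reg_equilibria (R : realType) (n m : nat) (G : game R n m)
    (eta : R) : set 'M[R]_(n, m) :=
  [set x | profiles G x /\ x = reg_best_response G eta (marginal_cost G x)].

Definition rel_nbhs (R : realType) (n m : nat) (K : set 'M[R]_(n, m))
    (x : 'M[R]_(n, m)) (U : set 'M[R]_(n, m)) : Prop :=
  U `<=` K /\ within K (nbhs x) U.

Definition locally_Lyapunov_stable (R : realType) (n m : nat)
    (G : game R n m) (eta : R) (xs : 'M[R]_(n, m)) : Prop :=
  forall U, rel_nbhs (profiles G) xs U ->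
  exists V, [/\ rel_nbhs (profiles G) xs V, V `<=` U &
    forall x, FW_solution G eta x -> V (x 0) -> forall t : R, 0 <= t -> U (x t)].

(* The second clause asserts the existence of a solution from every initial
   profile, so that convergence never holds vacuously. *)
Definition globally_asymptotically_stable (R : realType) (n m : nat)
    (G : game R n m) (eta : R) (X : set 'M[R]_(n, m)) : Prop :=
  (forall eps : R, 0 < eps -> exists2 delta : R, 0 < delta &
     forall x, FW_solution G eta x -> (edist_to (x 0%R) X <= delta%:E)%E ->
       forall t : R, 0 <= t -> (edist_to (x t) X <= eps%:E)%E)
  /\
  (forall x0, profiles G x0 ->
     (exists x, FW_solution G eta x /\ x 0 = x0) /\
     (forall x, FW_solution G eta x -> x 0 = x0 ->
        edist_to (x t) X @[t --> +oo] --> 0%E)).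

Definition univ_locally_FW_stable (R : realType) (n : nat)
    (C : set (R -> R)) : Prop :=
  forall (eta : R), 0 < eta ->
  forall (m : nat) (G : game R n m), (forall e, C (cost G e)) ->
  forall xs, reg_equilibria G eta xs -> locally_Lyapunov_stable G eta xs.

Definition univ_globally_FW_stable (R : realType) (n : nat)
    (C : set (R -> R)) : Prop :=
  forall (eta : R), 0 < eta ->
  forall (m : nat) (G : game R n m), (forall e, C (cost G e)) ->
  globally_asymptotically_stable G eta (reg_equilibria G eta).

Definition is_largest (T : Type) (P : set T -> Prop) (S : set T) : Prop :=
  P S /\ forall C, P C -> C `<=` S.

(* Main.v *)
Require Import Defs.
From mathcomp Require Import all_boot all_order all_algebra.
From mathcomp Require Import all_classical all_reals all_analysis.
From mathcomp Require Import ring lra.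

Set Implicit Arguments.
Unset Strict Implicit.
Unset Printing Implicit Defensive.

Import Order.TTheory GRing.Theory Num.Theory.
Import numFieldNormedType.Exports.

Local Open Scope classical_set_scope.
Local Open Scope ring_scope.

(** The condition defining Q_n is exactly monotonicity of the marginal cost
    operator F for n players.  At load L and with A = c'(L), B = c''(L), the
    derivative of F on one resource has quadratic form
    A (sigma^2 + |v|^2) + B sigma <x, v>, where sigma is the sum of the v_i.
    It is linear in x, so only the extreme cases in which one player carries
    the whole load matter; there 2 A + L B >= 0 and gamma_n A - L B >= 0 suffice
    (marginal_form_ge0), the second one being sharp for v_i = 1 and
    v_j = - 2 / (n - 1).

    If F is monotone, the regularized duality gap is a Lyapunov function: it is
    the maximum over y of
    <F x, x - y> + eta / 2 (|x|^2 - |y|^2), attained at the best response, so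
    by Danskin's rule (response_value_drv) its derivative along the flow is at
    most minus itself (gap_decay).  It dominates both the squared residual and
    the squared distance to an equilibrium (gap_ge_residual, gap_ge_dist).  The
    first bound produces an equilibrium as a minimizer of the residual
    (equilibrium_exists), the second its uniqueness, local and global
    stability.  Existence of solutions comes from compactness of the Euler
    schemes on the compact convex set of profiles (flow_exists).

    If some cost c of the class violates the condition at a load s, take n
    players and n resources, all with cost c + b, and let player i move on a
    segment in the sharp direction, with unit weight on resource i.  Symmetric
    profiles form a line X t on which the best response acts by t |-> B t, and
    the choice of b makes X 0 an equilibrium.  The derivative of B at 0 is
    minus the violated expression, perturbed to give all players some load on
    all resources (violation_split), divided by eta E; hence it is as large as
    desired for small eta.  The line is then repelling: trajectories starting
    arbitrarily close to X 0 reach a fixed distance from every equilibrium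
    (line_game_unstable), which excludes local stability of X 0 and global
    stability of the set of equilibria alike.  Closure of the class under
    affine changes is used precisely to have c + b in it. *)

(** * One-variable calculus relative to a subset of the line *)

(** Caratheodory's form of the derivative of f within D at x: difference
    quotients are replaced by a factor defined on all of D, so that the chain
    and product rules become identities between factors. *)
Definition drv_within (R : realType) (D : set R) (f : R -> R) (x l : R) : Prop :=
  exists phi : R -> R,
    (forall y, D y -> f y - f x = phi y * (y - x)) /\
    phi @ within D (nbhs x) --> l.

Section DrvWithin.
Variable R : realType.
Implicit Types (D E : set R) (f g : R -> R) (x l m : R).

Lemma drv_within_has_drv f x l :
  0 <= x -> has_drv (f : R -> R^o) x l -> drv_within (@Rplus R) f x l.
Proof.
move=> x0 fl.
exists (fun y => if y == x then l else (y - x)^-1 * (f y - f x)); split.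
  move=> y _; case: eqVneq => [->|yx]; first by rewrite !subrr mulr0.
  by rewrite mulrAC mulVf ?mul1r// subr_eq0.
move=> A Al.
have H : \forall y \near x, y != x -> 0 <= y -> A ((y - x)^-1 * (f y - f x)).
  exact: fl A Al.
suff : \forall y \near x, 0 <= y ->
  A (if y == x then l else (y - x)^-1 * (f y - f x)) by [].
apply: filterS H => y yA y0; case: eqVneq => [_|yx]; first exact: nbhs_singleton.
exact: yA.
Qed.

Lemma has_drv_drv_within f x l :
  drv_within (@Rplus R) f x l -> has_drv (f : R -> R^o) x l.
Proof.
move=> [phi [fE phil]] A Al.
have H : \forall y \near x, 0 <= y -> A (phi y) by exact: phil A Al.
suff : \forall y \near x, y != x -> 0 <= y -> A ((y - x)^-1 * (f y - f x)) by [].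
apply: filterS H => y yA yx y0.
by rewrite fE// mulrC mulfK ?subr_eq0//; exact: yA.
Qed.

Lemma drv_within_sub D E f x l :
  D `<=` E -> drv_within E f x l -> drv_within D f x l.
Proof.
move=> DE [phi [fE phil]]; exists phi; split=> [y /DE|A Al]; first exact: fE.
have H : \forall y \near x, E y -> A (phi y) by exact: phil A Al.
suff : \forall y \near x, D y -> A (phi y) by [].
by apply: filterS H => y yA /DE.
Qed.

Lemma drv_within_cvg D f x l : drv_within D f x l ->
  f @ within D (nbhs x) --> f x.
Proof.
move=> [phi [fE phil]].
have h : (fun y => f x + phi y * (y - x)) @ within D (nbhs x) --> f x.
  rewrite -[X in _ --> X]addr0 -(mulr0 l) -(subrr x).
  apply: cvgD; first exact: cvg_cst.
  apply: cvgM => //; apply: cvgB; last exact: cvg_cst.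
  by apply: cvg_within_filter; exact: cvg_id.
apply: cvg_trans h; apply: near_eq_cvg.
suff : \forall y \near x, D y -> f x + phi y * (y - x) = f y by [].
by apply: (@nearW _ (nbhs x)) => y /fE <-; rewrite addrC subrK.
Qed.

Lemma drv_within_ext D f g x l : (forall y, D y -> f y = g y) -> D x ->
  drv_within D f x l -> drv_within D g x l.
Proof.
move=> fg Dx [phi [fE phil]]; exists phi; split=> // y Dy.
by rewrite -!fg// fE.
Qed.

Lemma drv_within_cst D (c : R) x : drv_within D (fun=> c) x 0.
Proof. by exists (fun=> 0); split=> [y _|]; [rewrite subrr mul0r | exact: cvg_cst]. Qed.

Lemma drv_within_id D x : drv_within D id x 1.
Proof. by exists (fun=> 1); split=> [y _|]; [rewrite mul1r | exact: cvg_cst]. Qed.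

Lemma drv_withinD D f g x l m : drv_within D f x l -> drv_within D g x m ->
  drv_within D (fun y => f y + g y) x (l + m).
Proof.
move=> [p [fE pl]] [q [gE qm]]; exists (fun y => p y + q y); split; last first.
  exact: cvgD.
by move=> y Dy; rewrite mulrDl -fE// -gE//; ring.
Qed.

Lemma drv_withinM D f g x l m : drv_within D f x l -> drv_within D g x m ->
  drv_within D (fun y => f y * g y) x (l * g x + f x * m).
Proof.
move=> df dg; have gc := drv_within_cvg dg.
case: df dg => [p [fE pl]] [q [gE qm]].
exists (fun y => p y * g y + f x * q y); split; last first.
  apply: cvgD; first exact: cvgM.
  by apply: cvgM => //; exact: cvg_cst.
move=> y Dy; rewrite mulrDl mulrAC -fE// -mulrA -gE//; ring.
Qed.

Lemma drv_withinZ D (k : R) f x l : drv_within D f x l ->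
  drv_within D (fun y => k * f y) x (k * l).
Proof.
by move=> /(drv_withinM (drv_within_cst D k x)); rewrite mul0r add0r.
Qed.

Lemma drv_withinN D f x l : drv_within D f x l ->
  drv_within D (fun y => - f y) x (- l).
Proof.
move=> /(drv_withinZ (-1)); rewrite mulN1r.
by congr drv_within; apply/funext => y; rewrite mulN1r.
Qed.

Lemma drv_withinB D f g x l m : drv_within D f x l -> drv_within D g x m ->
  drv_within D (fun y => f y - g y) x (l - m).
Proof. by move=> df /drv_withinN; exact: drv_withinD. Qed.

Lemma drv_within_sum D (I : Type) (r : seq I) (f : I -> R -> R) (l : I -> R) x :
  (forall i, drv_within D (f i) x (l i)) ->
  drv_within D (fun y => \sum_(i <- r) f i y) x (\sum_(i <- r) l i).
Proof.
move=> df; elim: r => [|i r IH].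
  rewrite big_nil (_ : (fun _ => _) = fun=> 0); first exact: drv_within_cst.
  by apply/funext => y; rewrite big_nil.
rewrite big_cons (_ : (fun _ => _) = fun y => f i y + \sum_(j <- r) f j y).
  exact: drv_withinD.
by apply/funext => y; rewrite big_cons.
Qed.

Lemma drv_within_comp D E f g x l m : (forall y, D y -> E (g y)) ->
  drv_within E f (g x) l -> drv_within D g x m ->
  drv_within D (fun y => f (g y)) x (l * m).
Proof.
move=> DE [p [fE pl]] dg; have gc := drv_within_cvg dg.
case: dg => [q [gE qm]].
exists (fun y => p (g y) * q y); split.
  by move=> y Dy; rewrite -mulrA -gE// fE//; exact: DE.
apply: cvgM => //; apply: (@cvg_comp _ _ _ g p _ (within E (nbhs (g x)))) => //.
move=> A; rewrite /within /= => EA.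
have H : \forall y \near x, D y -> E (g y) -> A (g y) by exact: gc _ EA.
suff : \forall y \near x, D y -> A (g y) by [].
by apply: filterS H => y yA Dy; apply: yA => //; exact: DE.
Qed.

(** The mean value theorem on [a, b] applies because at interior points the
    derivative within D is two-sided. *)
Lemma drv_within_ge0_le (a b : R) (D : set R) (f df : R -> R) :
  a <= b -> `[a, b]%classic `<=` D ->
  (forall x, a <= x <= b -> drv_within D f x (df x)) ->
  (forall x, a <= x <= b -> 0 <= df x) -> f a <= f b.
Proof.
move=> ab abD fdf df0.
have fdf' x : a <= x <= b -> drv_within `[a, b]%classic f x (df x).
  by move=> /fdf; exact: drv_within_sub.
have [||c cab] := @MVT_segment R f df a b ab.
- move=> x xab.
  have xab' : a <= x <= b by move: xab; rewrite in_itv/= => /andP[/ltW-> /ltW].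
  have [phi [fE phil]] := fdf' x xab'.
  apply/is_derive1_caratheodory.
  exists (fun y => if y == x then df x else (y - x)^-1 * (f y - f x)); split.
  + move=> y; case: eqVneq => [->|yx]; first by rewrite !subrr mulr0.
    by rewrite mulrAC mulVf ?mul1r// subr_eq0.
  + move=> A; rewrite /= eqxx => Al.
    have H : \forall y \near x, `[a, b]%classic y -> A (phi y) by exact: phil A Al.
    suff : \forall y \near x,
      A (if y == x then df x else (y - x)^-1 * (f y - f x)) by [].
    near=> y; case: eqVneq => [_|yx]; first exact: nbhs_singleton.
    have yab : `[a, b]%classic y.
      by apply: subset_itv_oo_cc; near: y; exact: near_in_itvoo.
    rewrite fE// mulrC mulfK ?subr_eq0//; move: (yab); near: y; exact: H.
  + by rewrite /= eqxx.
- apply/subspace_continuousP => x xab.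
  exact/drv_within_cvg/fdf'.
- move=> fE; rewrite -subr_ge0 fE mulr_ge0 ?subr_ge0// df0//.
Unshelve. all: by end_near. Qed.

Lemma drv_within_le0_ge (a b : R) (D : set R) (f df : R -> R) :
  a <= b -> `[a, b]%classic `<=` D ->
  (forall x, a <= x <= b -> drv_within D f x (df x)) ->
  (forall x, a <= x <= b -> df x <= 0) -> f b <= f a.
Proof.
move=> ab abD fdf df0; rewrite -lerN2.
apply: (@drv_within_ge0_le a b D (fun x => - f x) (fun x => - df x)) => //.
  by move=> x /fdf; exact: drv_withinN.
by move=> x /df0; rewrite oppr_ge0.
Qed.

Lemma drv_within_lip (a b M : R) (D : set R) (f df : R -> R) :
  `[a, b]%classic `<=` D ->
  (forall x, a <= x <= b -> drv_within D f x (df x)) ->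
  (forall x, a <= x <= b -> `|df x| <= M) ->
  forall x y, a <= x <= b -> a <= y <= b -> `|f x - f y| <= M * `|x - y|.
Proof.
move=> abD fdf dfM.
suff le x y : a <= x <= b -> a <= y <= b -> x <= y ->
    `|f x - f y| <= M * `|x - y|.
  move=> x y xab yab; case: (leP x y) => [|/ltW yx]; first exact: le.
  by rewrite distrC (distrC x); exact: le.
move=> /andP[ax xb] /andP[ay yb] xy.
have xyD : `[x, y]%classic `<=` D.
  move=> z; rewrite /= in_itv/= => /andP[xz zy]; apply: abD.
  by rewrite /= in_itv/= (le_trans ax xz) (le_trans zy yb).
have xyab z : x <= z <= y -> a <= z <= b.
  by move=> /andP[xz zy]; rewrite (le_trans ax xz) (le_trans zy yb).
have dM z : drv_within D (fun u => M * u) z M.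
  by rewrite -[X in drv_within _ _ _ X]mulr1; exact/drv_withinZ/drv_within_id.
have h1 : M * x - f x <= M * y - f y.
  apply: (@drv_within_ge0_le x y D (fun u => M * u - f u) (fun u => M - df u)) => //.
    by move=> z /xyab/fdf; exact/drv_withinB.
  by move=> z /xyab/dfM; rewrite ler_norml subr_ge0 => /andP[].
have h2 : M * x + f x <= M * y + f y.
  apply: (@drv_within_ge0_le x y D (fun u => M * u + f u) (fun u => M + df u)) => //.
    by move=> z /xyab/fdf; exact/drv_withinD.
  by move=> z /xyab/dfM; rewrite ler_norml -lerBlDl sub0r => /andP[].
rewrite (distrC x) (ger0_norm (_ : 0 <= y - x)) ?subr_ge0// ler_norml.
by apply/andP; split; lra.
Qed.

Lemma dnbhs_Rplus_proper x : 0 <= x -> ProperFilter (within (@Rplus R) x^').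
Proof.
move=> x0; apply: Build_ProperFilter_ex => A.
rewrite /within /dnbhs /within /= => /nbhs_ballP[e /= e0 xeA].
exists (x + e / 2); apply: xeA.
- rewrite /ball /= opprD addNKr normrN gtr0_norm ?divr_gt0//; lra.
- by rewrite gt_eqF// ltrDl divr_gt0.
- by rewrite /Rplus /=; lra.
Qed.

(** The filter defining the derivative at a point of R_+ is proper, even at 0,
    so limits of difference quotients are unique. *)
Lemma drv_unique f x l : 0 <= x -> drv_within (@Rplus R) f x l -> drv f x = l.
Proof.
move=> x0 /has_drv_drv_within fl; have := dnbhs_Rplus_proper x0 => ?.
exact: cvg_lim fl.
Qed.

Lemma drvableP f : drvable f <->
  forall x, 0 <= x -> drv_within (@Rplus R) f x (drv f x).
Proof.
split=> df x x0; first exact/drv_within_has_drv/df.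
exact/has_drv_drv_within/df.
Qed.

(** The extreme value theorem bounds the continuous derivative on [0, b]. *)
Lemma drv_continuous_lip (h : R -> R) (b : R) : drvable h ->
  {within @Rplus R, continuous (drv h)} ->
  exists2 M, 0 <= M & forall x y, 0 <= x <= b -> 0 <= y <= b ->
    `|h x - h y| <= M * `|x - y|.
Proof.
move=> /drvableP dh ch.
have [b0|b0] := ltP b 0.
  by exists 0 => // x y /andP[x0 xb]; have := lt_le_trans b0 (le_trans x0 xb);
     rewrite ltxx.
have sub : `[0, b]%classic `<=` @Rplus R.
  by move=> z; rewrite /= in_itv/= => /andP[].
have [|c cb cM] := @EVT_max R (fun x => `|drv h x|) 0 b b0.
  apply/subspace_continuousP => x xb; apply: cvg_norm.
  by have /subspace_continuousP := continuous_subspaceW sub ch; exact.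
exists `|drv h c|; first exact: normr_ge0.
apply: (drv_within_lip sub) => [x /andP[x0 _]|x xb]; first exact: dh.
by apply: cM; rewrite in_itv.
Qed.

Lemma has_drv_coord (p q : nat) (x : R -> 'M[R]_(p, q)) t v i j :
  0 <= t -> has_drv x t v -> drv_within (@Rplus R) (fun s => x s i j) t (v i j).
Proof.
move=> t0 xv; apply: drv_within_has_drv => //.
rewrite /has_drv (_ : diff_quot _ t = fun s => diff_quot x t s i j).
  exact: cvg_comp _ _ xv (@coord_continuous R p q i j v).
by apply/funext => s; rewrite /diff_quot /= !mxE.
Qed.

End DrvWithin.

(** * Flows of Lipschitz fields on compact convex sets *)

Section UltrafilterLimits.

Lemma ultra_fmap (S T : Type) (f : S -> T) (U : set_system S) :
  UltraFilter U -> UltraFilter (f @ U).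
Proof.
move=> UU; have FP : ProperFilter (f @ U) := fmap_proper_filter f _.
apply: Build_UltraFilter => G GF UG; apply/seteqP; split=> // B GB.
have [//|UC] := in_ultra_setVsetC (f @^-1` B) UU.
have GC : G (~` B) by exact: UG.
by have /filter_ex[x []] : G (B `&` ~` B) by exact: filterI.
Qed.

(** One ultrafilter on the steps selects limits at all times simultaneously. *)
Lemma compact_ultra_lim (S : Type) (T : topologicalType) (K : set T)
    (f : S -> T) (U : set_system S) :
  UltraFilter U -> compact K -> (forall s, K (f s)) ->
  exists2 l, K l & f @ U --> l.
Proof.
move=> UU; rewrite compact_ultra => cK fK.
have [|l [Kl fl]] := cK _ (ultra_fmap f UU); last by exists l.
by have : U (f @^-1` K) by exact: filterE fK.
Qed.

End UltrafilterLimits.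

Section LipschitzFlow.
Variables (R : realType) (V : normedModType R) (K : set V) (G : V -> V).
Variables (L M : R).
Hypothesis cK : compact K.
Hypothesis stepK : forall x h, K x -> 0 <= h <= 1 -> K (x + h *: G x).
Hypothesis L0 : 0 <= L.
Hypothesis lipG : forall x y, K x -> K y -> `|G x - G y| <= L * `|x - y|.
Hypothesis bndG : forall x, K x -> `|G x| <= M.
Variable x0 : V.
Hypothesis Kx0 : K x0.

Definition euler (h : R) (k : nat) : V := iter k (fun x => x + h *: G x) x0.

Section EulerSteps.
Variable h : R.
Hypothesis h01 : 0 <= h <= 1.

Let h0 : 0 <= h. Proof. by case/andP: h01. Qed.

Let M0 : 0 <= M. Proof. exact: le_trans (normr_ge0 _) (bndG Kx0). Qed.

Lemma euler_in k : K (euler h k).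
Proof. by elim: k => [|k IH]//=; exact: stepK. Qed.

Lemma euler_dist k j : `|euler h (k + j) - euler h k| <= M * (j%:R * h).
Proof.
elim: j => [|j IH]; first by rewrite addn0 subrr normr0 mul0r mulr0.
rewrite addnS /= addrAC (le_trans (ler_normD _ _))// normrZ (ger0_norm h0).
have := bndG (euler_in (k + j)).
move=> /(ler_wpM2l h0); rewrite -natr1 mulrDl mul1r mulrDr => hM.
by rewrite lerD// (mulrC M).
Qed.

(** Consistency of the scheme: over j steps the field varies by at most L times
    the distance travelled, itself at most M times the elapsed time. *)
Lemma euler_linear k j :
  `|euler h (k + j) - euler h k - (j%:R * h) *: G (euler h k)| <=
  L * M * (j%:R * h) ^+ 2.
Proof.
elim: j => [|j IH].
  by rewrite addn0 subrr mul0r scale0r subrr normr0 expr0n/= mulr0.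
rewrite addnS /= -natr1.
have -> : euler h (k + j) + h *: G (euler h (k + j)) - euler h k -
    ((j%:R + 1) * h) *: G (euler h k) =
    (euler h (k + j) - euler h k - (j%:R * h) *: G (euler h k)) +
    h *: (G (euler h (k + j)) - G (euler h k)).
  rewrite mulrDl mul1r scalerDl scalerBr opprD !addrA; congr (_ - _).
  by rewrite -!addrA; congr (_ + _); rewrite addrC !addrA.
rewrite (le_trans (ler_normD _ _))// normrZ (ger0_norm h0).
have h1 : `|G (euler h (k + j)) - G (euler h k)| <= L * (M * (j%:R * h)).
  apply: (le_trans (lipG _ _)); [exact: euler_in..|].
  by apply: ler_wpM2l => //; exact: euler_dist.
have h2 := ler_wpM2l h0 h1.
have jh : 0 <= L * M * (h * (j%:R * h)).
  by rewrite !mulr_ge0.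
have hh : 0 <= L * M * (h * h) by rewrite !mulr_ge0.
by nra.
Qed.

End EulerSteps.

Definition euler_path (N : nat) (t : R) : V :=
  euler N.+1%:R^-1 (Num.truncn (t * N.+1%:R)).

Let h_in N : 0 <= (N.+1%:R^-1 : R) <= 1.
Proof. by rewrite invr_ge0 ler0n invf_le1 ?ltr0n// ler1n. Qed.

Lemma euler_path_in N t : K (euler_path N t).
Proof. exact: euler_in. Qed.

Lemma grid_duration N (s t : R) : 0 <= s -> s <= t ->
  exists2 j, Num.truncn (t * N.+1%:R) = (Num.truncn (s * N.+1%:R) + j)%N &
    `|j%:R * N.+1%:R^-1 - (t - s)| <= N.+1%:R^-1.
Proof.
move=> s0 st; set c : R := N.+1%:R.
have c0 : 0 < c by rewrite ltr0n.
have sc : 0 <= s * c by rewrite mulr_ge0// ltW.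
have stc : s * c <= t * c by rewrite ler_pM2r.
have tc : 0 <= t * c := le_trans sc stc.
exists (Num.truncn (t * c) - Num.truncn (s * c))%N.
  by rewrite subnKC// le_truncn.
have := truncn_itv tc; have := truncn_itv sc; rewrite -!natr1.
rewrite natrB ?le_truncn//.
set a : R := (Num.truncn (s * c))%:R; set b : R := (Num.truncn (t * c))%:R.
move=> /andP[a1 a2] /andP[b1 b2].
rewrite -(ler_pM2r c0) mulVf ?gt_eqF// -{2}(gtr0_norm c0) -normrM mulrBl.
rewrite -mulrA mulVf ?gt_eqF// mulr1 mulrBl ler_norml.
move: a1 a2 b1 b2; move: a b (s * c) (t * c) => a b u v a1 a2 b1 b2.
by apply/andP; split; lra.
Qed.

Lemma euler_path_dist N (s t : R) : 0 <= s -> s <= t ->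
  `|euler_path N t - euler_path N s| <= M * (t - s + N.+1%:R^-1).
Proof.
move=> s0 st; have [j jE jd] := grid_duration N s0 st.
rewrite /euler_path jE (le_trans (euler_dist (h_in N) _ _))//.
apply: ler_wpM2l; first exact: le_trans (normr_ge0 _) (bndG Kx0).
by move: jd; rewrite ler_norml => /andP[_]; rewrite lerBlDl.
Qed.

Lemma euler_path_linear N (s t : R) : 0 <= s -> s <= t ->
  `|euler_path N t - euler_path N s - (t - s) *: G (euler_path N s)| <=
  L * M * (t - s + N.+1%:R^-1) ^+ 2 + N.+1%:R^-1 * M.
Proof.
move=> s0 st; have [j jE jd] := grid_duration N s0 st.
have M0 : 0 <= M := le_trans (normr_ge0 _) (bndG Kx0).
have := euler_linear (h_in N) (Num.truncn (s * N.+1%:R)) j.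
rewrite -jE -/(euler_path N t) -/(euler_path N s).
move: (euler_path N t) (euler_path N s) (euler_path_in N s) => x y Ky.
move: jd; set h := N.+1%:R^-1; set d := j%:R * h => jd xy.
have -> : x - y - (t - s) *: G y = (x - y - d *: G y) + (d - (t - s)) *: G y.
  by rewrite [in RHS]scalerBl addrA subrK.
rewrite (le_trans (ler_normD _ _))// normrZ lerD//; last first.
  exact: ler_pM (normr_ge0 _) (normr_ge0 _) jd (bndG Ky).
apply: (le_trans xy); apply: ler_wpM2l; first exact: mulr_ge0.
have d0 : 0 <= d by rewrite mulr_ge0// invr_ge0.
rewrite lerXn2r// ?nnegrE//.
  by rewrite addr_ge0 ?subr_ge0// invr_ge0.
by move: jd; rewrite ler_norml => /andP[_]; rewrite lerBlDl.
Qed.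


Let cvg_step (U : set_system nat) : Filter U -> (\oo `<=` U) ->
  (N.+1%:R^-1 : R) @[N --> U] --> 0.
Proof. by move=> FU oU A A0; apply: oU; exact: cvg_harmonic A A0. Qed.

(** Pointwise limits of the Euler schemes along an ultrafilter exist by
    compactness, whatever their dependence on the step, and inherit the
    consistency estimate of the scheme. *)
Lemma flow_exists_quadratic : exists x : R -> V,
  [/\ x 0 = x0, (forall t, K (x t)),
      (forall s t, 0 <= s -> s <= t -> `|x t - x s| <= M * (t - s)) &
      (forall s t, 0 <= s -> s <= t ->
        `|x t - x s - (t - s) *: G (x s)| <= L * M * (t - s) ^+ 2)].
Proof.
have [U [UU oU]] := ultraFilterLemma (eventually_filter).
have FU : ProperFilter U := @ultra_proper _ U UU.
have /choice[x xP] t : exists l, K l /\ euler_path ^~ t @ U --> l.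
  have [|l Kl pl] := compact_ultra_lim (f := euler_path ^~ t) UU cK.
    by move=> N; exact: euler_path_in.
  by exists l.
have xK t : K (x t) by have [] := xP t.
have xl t : euler_path ^~ t @ U --> x t by have [] := xP t.
have Gl t : (fun N => G (euler_path N t)) @ U --> G (x t).
  apply/cvgrPdist_le => e e0; have L1 : 0 < L + 1 by rewrite ltr_wpDl.
  have /cvgrPdist_le/(_ _ (divr_gt0 e0 L1)) := xl t.
  apply: filterS => N; rewrite ler_pdivlMr// => le.
  apply: (le_trans (lipG (xK t) (euler_path_in N t))).
  by apply: le_trans le; rewrite mulrC ler_wpM2l// lerDl.
have hl := @cvg_step U _ oU.
have dl s t : (fun N : nat => t - s + (N.+1%:R^-1 : R)) @ U --> t - s.
  rewrite -[X in _ --> X]addr0.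
  apply: (@cvgD _ _ _ U _ (fun=> t - s)); [exact: cvg_cst | exact: hl].
exists x; split => //.
- have x0E : euler_path ^~ 0 @ U --> x0.
    rewrite (_ : euler_path ^~ 0 = fun=> x0); first exact: cvg_cst.
    by apply/funext => N; rewrite /euler_path mul0r truncn0.
  exact: cvg_unique (xl 0) x0E.
- move=> s t s0 st.
  apply: (@ler_cvg_to _ U FU _ (fun N => `|euler_path N t - euler_path N s|)
    (fun N => M * (t - s + N.+1%:R^-1))).
  + by apply: cvg_norm; exact: cvgB.
  + by apply: cvgM; [exact: cvg_cst | exact: dl].
  + by apply: nearW => N; exact: euler_path_dist.
- move=> s t s0 st.
  apply: (@ler_cvg_to _ U FU _
    (fun N => `|euler_path N t - euler_path N s - (t - s) *: G (euler_path N s)|)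
    (fun N => L * M * (t - s + N.+1%:R^-1) ^+ 2 + N.+1%:R^-1 * M)).
  + by apply: cvg_norm; apply: cvgB; [exact: cvgB | exact: cvgZr].
  + rewrite -[X in _ --> X]addr0; apply: cvgD; last first.
      by rewrite -(mul0r M); apply: cvgM; [exact: hl | exact: cvg_cst].
    apply: cvgM; first exact: cvg_cst.
    by rewrite expr2; under eq_fun do rewrite expr2; apply: cvgM; exact: dl.
  + by apply: nearW => N; exact: euler_path_linear.
Qed.

(** The quadratic estimate of the limit gives the right derivative; exchanging
    the two times and using that G and the limit are Lipschitz gives the left
    one. *)
Theorem flow_exists : exists x : R -> V,
  [/\ x 0 = x0, (forall t, K (x t)) & forall t, 0 <= t -> has_drv x t (G (x t))].
Proof.
have [x [xx0 xK xM xL]] := flow_exists_quadratic.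
exists x; split => // t t0.
have M0 : 0 <= M := le_trans (normr_ge0 _) (bndG Kx0).
have LM0 : 0 <= L * M by rewrite mulr_ge0.
have main r : 0 <= r ->
    `|x r - x t - (r - t) *: G (x t)| <= (L * M + L * M) * `|r - t| ^+ 2.
  move=> r0; case: (leP t r) => [tr|/ltW rt].
    apply: (le_trans (xL _ _ t0 tr)); rewrite ger0_norm ?subr_ge0//.
    by rewrite ler_wpM2r ?sqr_ge0// lerDl.
  have -> : x r - x t - (r - t) *: G (x t) =
      (t - r) *: (G (x t) - G (x r)) - (x t - x r - (t - r) *: G (x r)).
    rewrite -(opprB t r) scaleNr opprK [RHS]addrC scalerBr !opprB.
    by rewrite [RHS]addrC addrA subrK addrC.
  rewrite (le_trans (ler_normB _ _))// mulrDl lerD//; last first.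
    by rewrite (distrC r) (ger0_norm (_ : 0 <= t - r)) ?subr_ge0//; exact: xL.
  rewrite normrZ (distrC r); set d := `|t - r|.
  apply: le_trans (_ : d * (L * (M * d)) <= _); last first.
    by rewrite le_eqVlt; apply/orP; left; apply/eqP; ring.
  apply: ler_wpM2l; first exact: normr_ge0.
  apply: (le_trans (lipG (xK t) (xK r))).
  by apply: ler_wpM2l => //; rewrite /d ger0_norm ?subr_ge0//; exact: xM.
apply/cvgrPdist_le => e e0.
set C := L * M + L * M + 1; have C0 : 0 < C by rewrite /C ltr_wpDl ?addr_ge0.
suff : \forall r \near t, r != t -> 0 <= r ->
  `|G (x t) - (r - t)^-1 *: (x r - x t)| <= e by [].
near=> r => rt r0.
have rt0 : 0 < `|r - t| by rewrite normr_gt0 subr_eq0.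
rewrite -(ler_pM2l rt0) -normrZ scalerBr scalerA divff ?subr_eq0// scale1r distrC.
apply: (le_trans (main r r0)); rewrite expr2 mulrA mulrC.
rewrite ler_wpM2l ?normr_ge0//.
apply: (@le_trans _ _ (C * `|r - t|)).
  by rewrite ler_wpM2r// /C lerDl.
rewrite -ler_pdivlMl// mulrC.
rewrite distrC; near: r.
by apply: (@cvgr_dist_le _ _ _ (nbhs t) _ id t); [exact: cvg_id | rewrite divr_gt0].
Unshelve. all: by end_near. Qed.

End LipschitzFlow.

(** * Euclidean products and regularized best responses *)

Lemma sqr_homo (R : realType) (a b : R) : 0 <= a -> a <= b -> a ^+ 2 <= b ^+ 2.
Proof. by move=> a0 ab; rewrite !expr2; exact: ler_pM. Qed.

Lemma sqr_homo_inv (R : realType) (a b : R) : 0 <= b -> a ^+ 2 <= b ^+ 2 -> a <= b.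
Proof.
move=> b0; rewrite -ler_sqrt ?sqr_ge0// !sqrtr_sqr (ger0_norm b0).
exact: le_trans (ler_norm a).
Qed.

Lemma cvg_sumr (R : realType) (T I : Type) (F : set_system T) (r : seq I)
    (f : I -> T -> R) (l : I -> R) :
  Filter F -> (forall i, f i @ F --> l i) ->
  (fun t => \sum_(i <- r) f i t) @ F --> \sum_(i <- r) l i.
Proof.
move=> FF fl; elim: r => [|i r IH].
  rewrite big_nil (_ : (fun _ => _) = fun=> 0); first exact: cvg_cst.
  by apply/funext => t; rewrite big_nil.
rewrite big_cons (_ : (fun _ => _) = fun t => f i t + \sum_(j <- r) f j t).
  exact: cvgD.
by apply/funext => t; rewrite big_cons.
Qed.

Section MatrixTools.
Variables (R : realType) (p q : nat).
Implicit Types (x y z : 'M[R]_(p, q)).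

Lemma mx_norm_entry x i j : `|x i j| <= `|x|.
Proof.
rewrite [leRHS]/Num.norm/= mx_normrE.
exact: (le_bigmax _ (fun k : 'I_p * 'I_q => `|x k.1 k.2|) (i, j)).
Qed.

Lemma mx_norm_le x (e : R) : 0 <= e -> (forall i j, `|x i j| <= e) -> `|x| <= e.
Proof.
by move=> e0 xe; rewrite [leLHS]/Num.norm/= mx_normrE; apply: bigmax_le => // k _.
Qed.

Lemma cvg_mx (T : Type) (F : set_system T) (f : T -> 'M[R]_(p, q)) x :
  Filter F -> (forall i j, (fun t => f t i j) @ F --> x i j) -> f @ F --> x.
Proof.
move=> FF fx; apply/cvgrPdist_le => e e0.
have H (k : 'I_p * 'I_q) : \forall t \near F, `|x k.1 k.2 - f t k.1 k.2| <= e.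
  by have /cvgrPdist_le/(_ _ e0) := fx k.1 k.2.
have HF := filter_forall _ H.
near=> t; have ht : forall k : 'I_p * 'I_q, `|x k.1 k.2 - f t k.1 k.2| <= e.
  by near: t; exact: HF.
apply: mx_norm_le => [|i j]; first exact: ltW.
by rewrite !mxE; exact: (ht (i, j)).
Unshelve. all: by end_near. Qed.

Lemma cvg_mx_entry (T : Type) (F : set_system T) (f : T -> 'M[R]_(p, q)) x i j :
  Filter F -> f @ F --> x -> (fun t => f t i j) @ F --> x i j.
Proof.
move=> FF fx; apply: (cvg_comp _ (fun y : 'M[R]_(p, q) => y i j) fx).
exact: coord_continuous.
Qed.

Notation "<< x , y >>" := (eucl_dot x y).

Lemma dotC x y : <<x, y>> = <<y, x>>.
Proof. by apply: eq_bigr => i _; apply: eq_bigr => j _; rewrite mulrC. Qed.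

Lemma dotDl x y z : <<x + y, z>> = <<x, z>> + <<y, z>>.
Proof.
rewrite /eucl_dot -big_split; apply: eq_bigr => i _ /=.
by rewrite -big_split; apply: eq_bigr => j _; rewrite mxE mulrDl.
Qed.

Lemma dotZl a x y : <<a *: x, y>> = a * <<x, y>>.
Proof.
rewrite /eucl_dot mulr_sumr; apply: eq_bigr => i _.
by rewrite mulr_sumr; apply: eq_bigr => j _; rewrite mxE mulrA.
Qed.

Lemma dotNl x y : <<- x, y>> = - <<x, y>>.
Proof. by rewrite -scaleN1r dotZl mulN1r. Qed.

Lemma dotBl x y z : <<x - y, z>> = <<x, z>> - <<y, z>>.
Proof. by rewrite dotDl dotNl. Qed.

Lemma dotDr x y z : <<z, x + y>> = <<z, x>> + <<z, y>>.
Proof. by rewrite dotC dotDl !(dotC _ z). Qed.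

Lemma dotZr a x y : <<y, a *: x>> = a * <<y, x>>.
Proof. by rewrite dotC dotZl (dotC y). Qed.

Lemma dotNr x y : <<x, - y>> = - <<x, y>>.
Proof. by rewrite dotC dotNl dotC. Qed.

Definition dotE := (dotDl, dotDr, dotNl, dotNr, dotZl, dotZr).

Lemma dot_ge0 x : 0 <= <<x, x>>.
Proof. by apply: sumr_ge0 => i _; apply: sumr_ge0 => j _; rewrite -expr2 sqr_ge0. Qed.

Lemma norm_dot_le x y : `|<<x, y>>| <= (p * q)%:R * (`|x| * `|y|).
Proof.
rewrite (le_trans (ler_norm_sum _ _ _))//.
apply: (@le_trans _ _ (\sum_(i < p) \sum_(j < q) `|x| * `|y|)).
  apply: ler_sum => i _; rewrite (le_trans (ler_norm_sum _ _ _))//.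
  apply: ler_sum => j _; rewrite normrM.
  by apply: ler_pM => //; exact: mx_norm_entry.
by rewrite !sumr_const !card_ord -mulrnA mulr_natl mulnC.
Qed.

Lemma norm_sqr_le_dot x : `|x| ^+ 2 <= <<x, x>>.
Proof.
have -> : <<x, x>> = (Num.sqrt <<x, x>>) ^+ 2 by rewrite sqr_sqrtr// dot_ge0.
rewrite lerXn2r ?nnegrE ?sqrtr_ge0//; apply: mx_norm_le => [|i j].
  exact: sqrtr_ge0.
rewrite -sqrtr_sqr ler_wsqrtr// /eucl_dot (bigD1 i)//= (bigD1 j)//= -expr2.
rewrite -addrA lerDl addr_ge0//; first by apply: sumr_ge0 => k _; rewrite -expr2 sqr_ge0.
by apply: sumr_ge0 => k _; apply: sumr_ge0 => l _; rewrite -expr2 sqr_ge0.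
Qed.

Lemma dot_le0_eq0 x : <<x, x>> <= 0 -> x = 0.
Proof.
move=> x0; apply/eqP; rewrite -normr_eq0 -sqrf_eq0 eq_le sqr_ge0 andbT.
exact: le_trans (norm_sqr_le_dot x) x0.
Qed.

Lemma enorm_sqr x : enorm x ^+ 2 = <<x, x>>.
Proof. by rewrite sqr_sqrtr// dot_ge0. Qed.

Lemma norm_le_enorm x : `|x| <= enorm x.
Proof.
by rewrite -(@ler_pXn2r _ 2)// ?nnegrE ?sqrtr_ge0// enorm_sqr norm_sqr_le_dot.
Qed.

Lemma edist_to_singleton x y :
  edist_to x [set y] = (enorm (x - y))%:E.
Proof. by rewrite /edist_to image_set1 ereal_inf1. Qed.

Lemma dot_row x y : <<x, y>> = \sum_i <<row i x, row i y>>.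
Proof.
apply: eq_bigr => i _; rewrite /eucl_dot big_ord1.
by apply: eq_bigr => j _; rewrite !mxE.
Qed.

Lemma cvg_dot (T : Type) (F : set_system T) (f g : T -> 'M[R]_(p, q)) x y :
  Filter F -> f @ F --> x -> g @ F --> y ->
  (fun t => <<f t, g t>>) @ F --> <<x, y>>.
Proof.
move=> FF fx gy; rewrite /eucl_dot.
apply: cvg_sumr => i; apply: cvg_sumr => j.
by apply: cvgM; exact: cvg_mx_entry.
Qed.

End MatrixTools.

Section RegularizedResponse.
Variables (R : realType) (p q : nat) (K : set 'M[R]_(p, q)) (eta : R).
Hypothesis eta0 : 0 < eta.
Implicit Types (y z b : 'M[R]_(p, q)).

Notation "<< x , y >>" := (eucl_dot x y).

(** The first-order optimality condition of the strongly convex problem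
    defining the response to z. *)
Definition is_response z b : Prop :=
  K b /\ forall y, K y -> 0 <= <<z + eta *: b, y - b>>.

(** Completing the square at the response turns the variational inequality
    into quadratic growth of the regularized objective. *)
Lemma response_growth z b y : is_response z b -> K y ->
  <<z, b>> + eta / 2 * <<b, b>> + eta / 2 * <<y - b, y - b>> <=
  <<z, y>> + eta / 2 * <<y, y>>.
Proof.
move=> [_ bvi] /bvi; rewrite !dotE. rewrite (dotC y b).
by move: <<z, b>> <<b, b>> <<z, y>> <<y, y>> <<b, y>> => *; lra.
Qed.

Lemma response_monotone z z' b b' : is_response z b -> is_response z' b' ->
  eta * <<b - b', b - b'>> <= <<z - z', b' - b>>.
Proof.
move=> [Kb /(_ _ _)bvi] [Kb' /(_ _ _)bvi'].
have := bvi _ Kb'; have := bvi' _ Kb; rewrite !dotE !(dotC b' b).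
move: <<z, b>> <<z', b>> <<z, b'>> <<z', b'>> <<b, b>> <<b', b'>> <<b, b'>>.
by move=> *; lra.
Qed.

Lemma response_unique z b b' : is_response z b -> is_response z b' -> b = b'.
Proof.
move=> zb zb'; apply/eqP; rewrite -subr_eq0; apply/eqP/dot_le0_eq0.
have := response_monotone zb zb'.
have -> : z - z = 0 *: b by rewrite subrr scale0r.
by rewrite dotZl mul0r pmulr_rle0.
Qed.

(** The monotonicity inequality is Euclidean; comparing with the sup norm costs
    the number of entries. *)
Lemma response_lip z z' b b' : is_response z b -> is_response z' b' ->
  `|b - b'| <= (p * q)%:R / eta * `|z - z'|.
Proof.
move=> zb zb'; have := response_monotone zb zb'.
have [->|bb'] := eqVneq b b'.
  by rewrite subrr normr0 => _; rewrite !mulr_ge0// invr_ge0 ltW.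
have n0 : 0 < `|b - b'| by rewrite normr_gt0 subr_eq0.
move=> h; have h1 := ler_wpM2l (ltW eta0) (norm_sqr_le_dot (b - b')).
have h2 := le_trans (ler_norm _) (norm_dot_le (z - z') (b' - b)).
have := le_trans h1 (le_trans h h2); rewrite (distrC b' b) expr2 !mulrA.
by rewrite ler_pM2r// -ler_pdivlMl// => /le_trans; apply; rewrite mulrC mulrAC.
Qed.

(** Envelope estimate: the minimal value of the regularized objective is
    differentiable in z with gradient b, with a quadratic error. *)
Lemma response_value_diff z z' b b' : is_response z b -> is_response z' b' ->
  `|(<<z', b'>> + eta / 2 * <<b', b'>>) - (<<z, b>> + eta / 2 * <<b, b>>)
    - <<z' - z, b>>| <= <<z' - z, b - b'>>.
Proof.
move=> zb zb'; have [[Kb _] [Kb' _]] := (zb, zb').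
have := response_growth zb Kb'; have := response_growth zb' Kb.
have := dot_ge0 (b - b'); have := dot_ge0 (b' - b).
move=> h1 h2; have e1 := mulr_ge0 (ltW eta0) h1; have e2 := mulr_ge0 (ltW eta0) h2.
move=> h3 h4; rewrite ler_norml !dotE in h3 h4 e1 e2 *; move: h3 h4 e1 e2.
rewrite !(dotC b' b).
move: <<z, b>> <<z', b>> <<z, b'>> <<z', b'>> <<b, b>> <<b', b'>> <<b, b'>>.
by move=> *; apply/andP; split; lra.
Qed.

End RegularizedResponse.

Section BestResponse.
Variables (R : realType) (n m : nat) (G : game R n m) (eta : R).
Hypothesis eta0 : 0 < eta.

Notation "<< x , y >>" := (eucl_dot x y).

Lemma slope_ge0 (a c : R) :
  (forall s, 0 < s <= 1 -> 0 <= s * a + s ^+ 2 * c) -> 0 <= a.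
Proof.
move=> H; rewrite leNgt; apply/negP => a0.
have c1 : 0 < `|c| + 1 by rewrite ltr_wpDl.
pose s := Num.min 1 (- a / (2 * (`|c| + 1))).
have s0 : 0 < s by rewrite lt_min ltr01 divr_gt0 ?oppr_gt0// mulr_gt0.
have s1 : s <= 1 by rewrite ge_min lexx.
have sc : s * (2 * (`|c| + 1)) <= - a.
  by rewrite -ler_pdivlMr ?mulr_gt0// ge_min lexx orbT.
have := H s; rewrite s0 s1 => /(_ isT).
rewrite expr2 -mulrA -mulrDr pmulr_rge0//; apply/negP; rewrite -ltNge.
have := ler_wpM2l (ltW s0) (ler_norm c); nra.
Qed.

Lemma strat_segment i (x y : 'rV[R]_m) s : strat G i x -> strat G i y ->
  0 <= s <= 1 -> strat G i (x + s *: (y - x)).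
Proof.
move=> Kx Ky /andP[s0 s1].
have /set_mem := strat_convex (Itv01 s0 s1) (mem_set Ky) (mem_set Kx).
congr (strat G i _); rewrite /conv/=.
by rewrite scalerBr scalerBl scale1r addrC -!addrA; congr (_ + _); exact: addrC.
Qed.

Lemma argmin_exists i (z : 'rV[R]_m) : exists b : 'rV[R]_m,
  argmin (strat G i) (fun y => <<z, y>> + eta / 2 * enorm y ^+ 2) b.
Proof.
have [|b Kb bmin] := @compact_EVT_min _ R
  (fun y => <<z, y>> + eta / 2 * enorm y ^+ 2) _ (@strat_nonempty _ _ _ G i)
  (@strat_compact _ _ _ G i).
  apply: continuous_subspaceT => y.
  have c1 : (fun x => <<z, x>>) @ nbhs y --> <<z, y>>.
    by apply: (@cvg_dot _ _ _ _ (nbhs y) (fun=> z) id); [exact: cvg_cst|exact: cvg_id].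
  have c2 : (fun x => <<x, x>>) @ nbhs y --> <<y, y>>.
    by apply: (@cvg_dot _ _ _ _ (nbhs y) id id); exact: cvg_id.
  have c3 := cvgD c1 (cvgM (cvg_cst (eta / 2)) c2).
  rewrite /continuous_at enorm_sqr.
  rewrite (_ : (fun y0 => _) = fun x => <<z, x>> + eta / 2 * <<x, x>>) //.
    exact: c3.
  by apply/funext => x; rewrite enorm_sqr.
by exists b; split=> [|y /mem_set]; [exact: set_mem | exact: bmin].
Qed.

(** Optimality against the points of the segment from b to y forces the linear
    coefficient of the objective along it to be nonnegative. *)
Lemma argmin_response i (z b : 'rV[R]_m) :
  argmin (strat G i) (fun y => <<z, y>> + eta / 2 * enorm y ^+ 2) b ->
  is_response (strat G i) eta z b.
Proof.
move=> [Kb bmin]; split=> // y Ky.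
apply: (@slope_ge0 _ (eta / 2 * <<y - b, y - b>>)) => s /andP[s0 s1].
have Kys : strat G i (b + s *: (y - b)).
  by apply: strat_segment => //; rewrite (ltW s0).
have := bmin _ Kys; rewrite !enorm_sqr !dotE !(dotC y b).
move: <<z, b>> <<z, y>> <<b, b>> <<b, y>> <<y, y>> => *; nra.
Qed.

(** Strategies of different players are chosen independently, so the rowwise
    variational inequalities add up to one over all profiles. *)
Lemma reg_best_responseP z : is_response (profiles G) eta z (reg_best_response G eta z).
Proof.
have rowP i : is_response (strat G i) eta (row i z)
    (row i (reg_best_response G eta z)).
  apply: argmin_response; rewrite rowK.
  have [b bmin] := argmin_exists i (row i z).
  exact: xgetI bmin.
split=> [i|y Ky]; first by case: (rowP i).
rewrite dot_row; apply: sumr_ge0 => i _.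
have [_ /(_ _ (Ky i))] := rowP i.
by rewrite !linearD !linearN !linearZ.
Qed.

Lemma reg_best_response_unique z b :
  is_response (profiles G) eta z b -> reg_best_response G eta z = b.
Proof. exact: response_unique (reg_best_responseP z). Qed.

Lemma profiles_segment x y s : profiles G x -> profiles G y -> 0 <= s <= 1 ->
  profiles G (x + s *: (y - x)).
Proof.
move=> Kx Ky s01 i; rewrite linearD linearZ linearB; exact: strat_segment.
Qed.

Lemma profiles_nonempty : profiles G !=set0.
Proof.
have /choice[f fK] : forall i, exists y, strat G i y by exact: strat_nonempty.
by exists (\matrix_i f i) => i; rewrite rowK.
Qed.

(** Rows converge separately along an ultrafilter. *)
Lemma profiles_compact : compact (profiles G).
Proof.
rewrite compact_ultra => U UU UK.
have lim i : exists l, strat G i l /\ row i @ U --> l.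
  have := @strat_compact _ _ _ G i; rewrite compact_ultra.
  move=> /(_ _ (ultra_fmap (row i) UU))[|l [Kl Ul]]; last by exists l.
  by have : U [set x | strat G i (row i x)] by apply: filterS UK => x; exact.
have /choice[l lP] := lim; exists (\matrix_i l i); split=> [i|/=].
  by rewrite rowK; case: (lP i).
apply: (@cvg_mx _ _ _ _ U id) => i j; rewrite mxE.
have [_ li] := lP i; have := @cvg_mx_entry _ _ _ _ U _ _ ord0 j _ li.
rewrite (_ : (fun t => row i t ord0 j) = fun t => t i j); first exact.
by apply/funext => t; rewrite mxE.
Qed.

Lemma profiles_ge0 x i e : profiles G x -> 0 <= x i e.
Proof. by move=> /(_ i)/strat_ge0/(_ e); rewrite mxE. Qed.

End BestResponse.

(** * Marginal costs *)

Section QuadraticForm.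
Variable R : realType.

(** Cauchy-Schwarz over the n - 1 indices other than i. *)
Lemma sum_others_sqr (n : nat) (v : 'I_n -> R) i : (2 <= n)%N ->
  (\sum_j v j - v i) ^+ 2 <= (n%:R - 1) * (\sum_j v j ^+ 2 - v i ^+ 2).
Proof.
move=> n2; set N : R := n%:R - 1.
have N0 : 0 < N by rewrite subr_gt0 ltr1n.
rewrite (bigD1 i)//= (bigD1 i (F := fun j => v j ^+ 2))//=.
rewrite (addrC (v i)) addrK (addrC (v i ^+ 2)) addrK.
set w := \sum_(_ | _) v _; set S := \sum_(_ | _) _.
have cardN : \sum_(j | j != i) (1 : R) = N.
  by rewrite sumr_const cardC1 card_ord /N; case: (n) n2 => // k _; rewrite -natr1 addrK.
have : 0 <= \sum_(j | j != i) (N * v j - w) ^+ 2.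
  by apply: sumr_ge0 => j _; exact: sqr_ge0.
have expand u : \sum_(j | j != i) (N * v j - u) ^+ 2 =
    N ^+ 2 * S - 2 * N * u * w + u ^+ 2 * N.
  rewrite -[X in _ + u ^+ 2 * X]cardN /S /w !mulr_sumr -sumrN -!big_split/=.
  by apply: eq_bigr => j _; ring.
rewrite expand.
have -> : N ^+ 2 * S - 2 * N * w * w + w ^+ 2 * N = N * (N * S - w ^+ 2) by ring.
by rewrite pmulr_rge0// subr_ge0.
Qed.

(** Averaging over players with weights x_i / L, it suffices to treat
    x_i = L, and the form is affine in L * B.  At the end L * B = - 2 A it is
    A * ((sigma - v_i)^2 + ...), and at the other end the constant gamma_n is
    the one for which the Cauchy-Schwarz bound over the other players leaves
    n / (n - 1) * A * (sigma + v_i)^2. *)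
Lemma marginal_form_ge0 (n : nat) (A B : R) (x v : 'I_n -> R) : (2 <= n)%N ->
  (forall i, 0 <= x i) ->
  0 <= A -> 0 <= 2 * A + (\sum_i x i) * B ->
  0 <= gamma_n R n * A - (\sum_i x i) * B ->
  0 <= A * ((\sum_i v i) ^+ 2 + \sum_i v i ^+ 2) +
       B * (\sum_i v i) * \sum_i x i * v i.
Proof.
move=> n2 x0 A0; set L := \sum_i x i; set s := \sum_i v i; set q := \sum_i v i ^+ 2.
move=> lo hi; have L0 : 0 <= L by exact: sumr_ge0.
have q0 : 0 <= q by apply: sumr_ge0 => i _; exact: sqr_ge0.
have [/eqP L_eq0|Ln0] := boolP (L == 0).
  rewrite [\sum_i _](_ : _ = 0) ?mulr0 ?addr0 ?mulr_ge0 ?addr_ge0 ?sqr_ge0//.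
  apply: big1 => i _; rewrite (_ : x i = 0) ?mul0r//.
  by move/eqP: L_eq0; rewrite psumr_eq0// => /allP/(_ i (mem_index_enum _))/eqP.
have Lp : 0 < L by rewrite lt_neqAle eq_sym Ln0.
rewrite -(pmulr_rge0 _ Lp).
have -> : L * (A * (s ^+ 2 + q) + B * s * \sum_i x i * v i) =
    \sum_i x i * (A * (s ^+ 2 + q) + (L * B) * (s * v i)).
  transitivity (\sum_i (x i * (A * (s ^+ 2 + q)) + L * B * s * (x i * v i))).
    rewrite big_split/= -mulr_suml -mulr_sumr -/L. ring.
  by apply: eq_bigr => i _; ring.
apply: sumr_ge0 => i _; apply: mulr_ge0 => //.
have vq : v i ^+ 2 <= q.
  by rewrite /q (bigD1 i)//= lerDl sumr_ge0// => j _; exact: sqr_ge0.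
have [sv|/ltW sv] := leP 0 (s * v i).
  have h1 : 0 <= A * ((s - v i) ^+ 2 + (q - v i ^+ 2)).
    by rewrite mulr_ge0// addr_ge0 ?sqr_ge0// subr_ge0.
  have h2 : 0 <= (2 * A + L * B) * (s * v i) by rewrite mulr_ge0.
  apply: le_trans (addr_ge0 h1 h2) _.
  by rewrite le_eqVlt; apply/orP; left; apply/eqP; ring.
set N : R := n%:R - 1; have N0 : 0 < N by rewrite subr_gt0 ltr1n.
have gN : gamma_n R n * N = 2 * (N + 2).
  by rewrite /gamma_n -/N mulfVK ?gt_eqF// /N; ring.
have cs : (s - v i) ^+ 2 <= N * (q - v i ^+ 2) by exact: sum_others_sqr.
have h2 : 0 <= (gamma_n R n * A - L * B) * - (s * v i) by rewrite mulr_ge0 ?oppr_ge0.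
have h3 : 0 <= (N + 1) * (s + v i) ^+ 2 by rewrite mulr_ge0 ?sqr_ge0// addr_ge0 ?ltW.
have h1 : 0 <= N * (s ^+ 2 + q + gamma_n R n * (s * v i)).
  have -> : N * (s ^+ 2 + q + gamma_n R n * (s * v i)) =
      N * s ^+ 2 + N * q + 2 * (N + 2) * (s * v i) by rewrite -gN; ring.
  nra.
rewrite pmulr_rge0// in h1.
apply: le_trans (addr_ge0 (mulr_ge0 A0 h1) h2) _.
by rewrite le_eqVlt; apply/orP; left; apply/eqP; ring.
Qed.

End QuadraticForm.

Section Costs.
Variable R : realType.
Implicit Types (c f : R -> R).

Lemma class_D_drv c : class_D c ->
  forall x, 0 <= x -> drv_within (@Rplus R) c x (drv c x).
Proof. by move=> [[/drvableP]]. Qed.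

Lemma class_D_drv2 c : class_D c ->
  forall x, 0 <= x -> drv_within (@Rplus R) (drv c) x (drv (drv c) x).
Proof. by move=> [[_ /drvableP]]. Qed.

Lemma class_D_lip c (b : R) : class_D c -> 0 <= b -> exists2 M, 0 <= M &
  forall x y, 0 <= x <= b -> 0 <= y <= b ->
  [/\ `|c x - c y| <= M * `|x - y|, `|drv c x - drv c y| <= M * `|x - y| &
      `|drv c x| <= M].
Proof.
move=> cD b0; have [[dc ddc cddc] _] := cD.
have cdc : {within @Rplus R, continuous (drv c)}.
  by apply/subspace_continuousP => x x0; exact: drv_within_cvg (class_D_drv2 cD x0).
have [M1 M10 lip1] := drv_continuous_lip b dc cdc.
have [M2 M20 lip2] := drv_continuous_lip b ddc cddc.
have bb : (0 : R) <= (0 : R) <= b by apply/andP.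
have M0 : 0 <= M1 + M2 + (`|drv c 0| + M2 * b).
  by rewrite !addr_ge0// mulr_ge0.
exists (M1 + M2 + (`|drv c 0| + M2 * b)) => // x y xb yb; split.
- apply: le_trans (lip1 _ _ xb yb) _; apply: ler_wpM2r => //.
  by rewrite -addrA lerDl !addr_ge0// mulr_ge0.
- apply: le_trans (lip2 _ _ xb yb) _; apply: ler_wpM2r => //.
  by rewrite (addrC M1) -addrA lerDl !addr_ge0// mulr_ge0.
- have h := lip2 _ _ xb bb; rewrite subr0 in h.
  have -> : drv c x = (drv c x - drv c 0) + drv c 0 by rewrite subrK.
  have xb' : M2 * `|x| <= M2 * b.
    by case/andP: xb => x0 xb; rewrite ler_wpM2l// ger0_norm.
  rewrite (le_trans (ler_normD _ _))//.
  apply: (@le_trans _ _ (M2 * b + `|drv c 0|)).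
    by rewrite lerD2r (le_trans h).
  by rewrite addrC lerDr addr_ge0.
Qed.

Lemma drv_affine f a b x l : drv_within (@Rplus R) f x l ->
  drv_within (@Rplus R) (fun y => a * f y + b) x (a * l).
Proof.
move=> fl; rewrite -[X in drv_within _ _ _ X]addr0.
by apply: drv_withinD; [exact: drv_withinZ | exact: drv_within_cst].
Qed.

Lemma class_D_affine f a b : 0 < a -> class_D f -> [/\ class_D (fun x => a * f x + b),
  forall x, 0 <= x -> drv (fun x => a * f x + b) x = a * drv f x &
  forall x, 0 <= x -> drv (drv (fun x => a * f x + b)) x = a * drv (drv f) x].
Proof.
move=> a0 fD; set g := fun x => _.
have gE x : 0 <= x -> drv g x = a * drv f x.
  by move=> x0; apply: drv_unique => //; exact/drv_affine/class_D_drv.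
have dgd x : 0 <= x -> drv_within (@Rplus R) (drv g) x (a * drv (drv f) x).
  move=> x0; apply: (@drv_within_ext _ _ (fun y => a * drv f y)) => //.
    by move=> y y0; rewrite gE.
  exact/drv_withinZ/class_D_drv2.
have ggE x : 0 <= x -> drv (drv g) x = a * drv (drv f) x.
  by move=> x0; apply: drv_unique => //; exact: dgd.
split=> //; split; last first.
  move=> x x0; have [_ /(_ x x0) [h1 h2]] := fD.
  rewrite gE// ggE//; split; first by rewrite mulr_ge0// ltW.
  have -> : 2 * (a * drv f x) + x * (a * drv (drv f) x) =
    a * (2 * drv f x + x * drv (drv f) x) by ring.
  by rewrite mulr_ge0// ltW.
split.
- by apply/drvableP => x x0; rewrite gE//; exact/drv_affine/class_D_drv.
- by apply/drvableP => x x0; rewrite ggE//; exact: dgd.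
- have [[_ _ /subspace_continuousP cf] _] := fD.
  apply/subspace_continuousP => x x0.
  have h : (fun y => a * drv (drv f) y) @ within (@Rplus R) (nbhs x) -->
      drv (drv g) x.
    by rewrite ggE//; apply: cvgM; [exact: cvg_cst | exact: cf].
  apply: cvg_trans h; apply: near_eq_cvg.
  suff : \forall y \near x, 0 <= y -> a * drv (drv f) y = drv (drv g) y by [].
  by apply: (@nearW _ (nbhs x)) => y y0; exact/esym/ggE.
Qed.

Lemma class_Q_PAT n : PAT_closed (@class_Q R n).
Proof.
split=> [f []//|f [fD fQ] a b a0].
have [gD gE ggE] := class_D_affine b a0 fD; split=> // x x0.
rewrite gE// ggE//.
have -> : gamma_n R n * (a * drv f x) - x * (a * drv (drv f) x) =
  a * (gamma_n R n * drv f x - x * drv (drv f) x) by ring.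
by rewrite mulr_ge0 ?fQ// ltW.
Qed.

End Costs.

Section MarginalCost.
Variables (R : realType) (n m : nat) (G : game R n m).
Implicit Types (x y v : 'M[R]_(n, m)).

Notation "<< x , y >>" := (eucl_dot x y).

Lemma load_ge0 x e : (forall i, 0 <= x i e) -> 0 <= load x e.
Proof. by move=> x0; apply: sumr_ge0. Qed.

Definition marginal_drv x v : 'M[R]_(n, m) :=
  \matrix_(i, e)
    (drv (cost G e) (load x e) * load v e +
     (v i e * drv (cost G e) (load x e) +
      x i e * (drv (drv (cost G e)) (load x e) * load v e))).

Lemma marginal_drv_curve (D : set R) (x : R -> 'M[R]_(n, m)) t v :
  (forall s, D s -> forall i e, 0 <= x s i e) -> D t ->
  (forall i e, drv_within D (fun s => x s i e) t (v i e)) ->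
  forall i e, drv_within D (fun s => marginal_cost G (x s) i e) t
    (marginal_drv (x t) v i e).
Proof.
move=> x0 Dt xv i e.
have lv : drv_within D (fun s => load (x s) e) t (load v e).
  by apply: drv_within_sum.
have Dl : forall s, D s -> Rplus (load (x s) e).
  by move=> s Ds; apply: load_ge0 => j; exact: x0.
have cD := @cost_class_D _ _ _ G e.
rewrite mxE (_ : (fun s => _) = fun s => cost G e (load (x s) e) +
    x s i e * drv (cost G e) (load (x s) e)); last by apply/funext => s; rewrite mxE.
apply: drv_withinD.
  by apply: (drv_within_comp Dl _ lv); exact: (class_D_drv cD (Dl _ Dt)).
apply: drv_withinM; first exact: xv.
by apply: (drv_within_comp Dl _ lv); exact: (class_D_drv2 cD (Dl _ Dt)).
Qed.

Lemma marginal_form_sum (A B : R) (x v : 'I_n -> R) :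
  \sum_i (A * (\sum_j v j) + (v i * A + x i * (B * (\sum_j v j)))) * v i =
  A * ((\sum_i v i) ^+ 2 + \sum_i v i ^+ 2) + B * (\sum_i v i) * \sum_i x i * v i.
Proof.
set s := \sum_j v j.
transitivity (\sum_i (A * s * v i + A * v i ^+ 2 + B * s * (x i * v i))).
  by apply: eq_bigr => i _; ring.
by rewrite !big_split/= -!mulr_sumr -/s; ring.
Qed.

Section Monotone.
Hypothesis n2 : (2 <= n)%N.
Hypothesis costQ : forall e, @class_Q R n (cost G e).

Lemma marginal_drv_ge0 x v : (forall i e, 0 <= x i e) -> 0 <= <<marginal_drv x v, v>>.
Proof.
move=> x0; rewrite /eucl_dot exchange_big /=; apply: sumr_ge0 => e _.
have [[_ /(_ _ (load_ge0 (fun i => x0 i e)))[A0 lo]]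
       /(_ _ (load_ge0 (fun i => x0 i e))) hi] := costQ e.
have := @marginal_form_ge0 R n _ _ (fun i => x i e) (fun i => v i e) n2
   (fun i => x0 i e) A0 lo hi.
rewrite -/(load v e) -/(load x e) -marginal_form_sum.
by congr (_ <= _); apply: eq_bigr => i _; rewrite mxE.
Qed.

(** Positivity of the derivative, integrated along the segment from y to x. *)
Lemma marginal_monotone x y : profiles G x -> profiles G y ->
  0 <= <<marginal_cost G x - marginal_cost G y, x - y>>.
Proof.
move=> Kx Ky; pose z s : 'M[R]_(n, m) := y + s *: (x - y).
have zK s : 0 <= s <= 1 -> profiles G (z s) by exact: profiles_segment.
have zD s : `[0, 1]%classic s -> forall i e, 0 <= z s i e.
  by rewrite /= in_itv => s01 i e; exact: profiles_ge0 (zK s s01).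
have zv s i e : drv_within `[0, 1]%classic (fun u => z u i e) s ((x - y) i e).
  rewrite (_ : (fun u => _) = fun u => y i e + u * (x - y) i e).
    rewrite -[X in drv_within _ _ _ X]add0r; apply: drv_withinD.
      exact: drv_within_cst.
    rewrite -[X in drv_within _ _ _ X]mul1r -[X in drv_within _ _ _ X]addr0.
    rewrite -[X in drv_within _ _ _ (_ + X)](mulr0 s).
    by apply: drv_withinM; [exact: drv_within_id | exact: drv_within_cst].
  by apply/funext => u; rewrite !mxE.
pose phi s := <<marginal_cost G (z s), x - y>>.
have : phi 0 <= phi 1.
  apply: (@drv_within_ge0_le _ _ _ `[0, 1]%classic phi
    (fun s => <<marginal_drv (z s) (x - y), x - y>>)) => // s s01.
    apply: drv_within_sum => i; apply: drv_within_sum => e.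
    rewrite -[X in drv_within _ _ _ X]addr0.
    rewrite -[X in drv_within _ _ _ (_ + X)](mulr0 (marginal_cost G (z s) i e)).
    apply: drv_withinM; last exact: drv_within_cst.
    by apply: marginal_drv_curve => //; rewrite /= in_itv.
  by apply: marginal_drv_ge0 => i e; apply: zD; rewrite /= in_itv.
by rewrite /phi /z scale0r addr0 scale1r [y + _]addrC subrK dotBl subr_ge0.
Qed.

End Monotone.

Lemma load_norm_le x e : `|load x e| <= n%:R * `|x|.
Proof.
rewrite (le_trans (ler_norm_sum _ _ _))//.
apply: (@le_trans _ _ (\sum_(i < n) `|x|)).
  by apply: ler_sum => i _; exact: mx_norm_entry.
by rewrite sumr_const card_ord mulr_natl.
Qed.

Lemma profiles_bounded : exists2 B, 0 <= B & forall x, profiles G x -> `|x| <= B.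
Proof.
have := compact_bounded (@profiles_compact _ _ _ G).
move=> /(@pinfty_ex_gt _ 0 _ (num_real 0))[B B0 xB].
by exists B; [exact: ltW|exact: xB].
Qed.

Lemma marginal_lip : exists2 L, 0 <= L & forall x y, profiles G x -> profiles G y ->
  `|marginal_cost G x - marginal_cost G y| <= L * `|x - y|.
Proof.
have [B B0 KB] := profiles_bounded.
pose b := n%:R * B; have b0 : 0 <= b by rewrite mulr_ge0.
have lb x e : profiles G x -> 0 <= load x e <= b.
  move=> Kx; rewrite load_ge0/=; last by move=> i; exact: profiles_ge0.
  rewrite (le_trans (ler_norm _))// (le_trans (load_norm_le _ _))//.
  by rewrite ler_wpM2l// KB.
have /choice[M MP] : forall e, exists M, 0 <= M /\
  forall x y : R, 0 <= x <= b -> 0 <= y <= b ->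
  [/\ `|cost G e x - cost G e y| <= M * `|x - y|,
      `|drv (cost G e) x - drv (cost G e) y| <= M * `|x - y| &
      `|drv (cost G e) x| <= M].
  move=> e; have [M M0 lip] := class_D_lip (@cost_class_D _ _ _ G e) b0.
  by exists M.
have M0 e : 0 <= M e by case: (MP e).
pose S := \sum_e M e; have S0 : 0 <= S by exact: sumr_ge0.
have MS e : M e <= S by rewrite /S (bigD1 e)//= lerDl sumr_ge0.
exists (S * (n%:R + (1 + B * n%:R))) => [|x y Kx Ky].
  by rewrite mulr_ge0// !addr_ge0// mulr_ge0.
apply: mx_norm_le => [|i e].
  by rewrite !mulr_ge0// !addr_ge0// mulr_ge0.
have [_ /(_ _ _ (lb x e Kx) (lb y e Ky))[h1 h2 h3]] := MP e.
have lxy : `|load x e - load y e| <= n%:R * `|x - y|.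
  apply: le_trans (load_norm_le (x - y) e).
  by rewrite /load -sumrB; under [in leRHS]eq_bigr do rewrite !mxE.
have xye : `|x i e - y i e| <= `|x - y|.
  by have := mx_norm_entry (x - y) i e; rewrite !mxE.
have yB : `|y i e| <= B by rewrite (le_trans (mx_norm_entry _ _ _))// KB.
have g1 : `|cost G e (load x e) - cost G e (load y e)| <= S * (n%:R * `|x - y|).
  by rewrite (le_trans h1)// ler_pM.
have g2 : `|drv (cost G e) (load x e) - drv (cost G e) (load y e)|
    <= S * (n%:R * `|x - y|).
  by rewrite (le_trans h2)// ler_pM.
have g3 : `|drv (cost G e) (load x e)| <= S by rewrite (le_trans h3).
rewrite !mxE.
set c1 := cost G e _; set c2 := cost G e _; set d1 := drv _ _; set d2 := drv _ _.
rewrite -/c1 -/c2 -/d1 -/d2 in g1 g2 g3.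
have -> : c1 + x i e * d1 - (c2 + y i e * d2) =
  (c1 - c2) + ((x i e - y i e) * d1 + y i e * (d1 - d2)) by ring.
have -> : S * (n%:R + (1 + B * n%:R)) * `|x - y| =
  S * (n%:R * `|x - y|) + (`|x - y| * S + B * (S * (n%:R * `|x - y|))) by ring.
apply: le_trans (ler_normD _ _) _; apply: lerD => //.
by apply: le_trans (ler_normD _ _) _; apply: lerD; rewrite normrM ler_pM.
Qed.

End MarginalCost.

(** * Global stability under the marginal condition *)

(** Danskin's rule along a curve of price vectors: the minimal value of the
    regularized objective varies as if the response were frozen. *)
Lemma response_value_drv (R : realType) (p q : nat) (K : set 'M[R]_(p, q))
    (eta : R) (D : set R) (z b : R -> 'M[R]_(p, q)) t (l : 'M[R]_(p, q)) :
  0 < eta -> (forall s, D s -> is_response K eta (z s) (b s)) -> D t ->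
  (forall i j, drv_within D (fun s => z s i j) t (l i j)) ->
  drv_within D (fun s => eucl_dot (z s) (b s) + eta / 2 * eucl_dot (b s) (b s))
    t (eucl_dot l (b t)).
Proof.
move=> eta0 zb Dt zl; set m := fun s => _.
have /choice[zeta zetaP] : forall k : 'I_p * 'I_q, exists phi : R -> R,
    (forall y, D y -> z y k.1 k.2 - z t k.1 k.2 = phi y * (y - t)) /\
    phi @ within D (nbhs t) --> l k.1 k.2 by move=> k; exact: zl.
pose Z s : 'M[R]_(p, q) := \matrix_(i, j) zeta (i, j) s.
have ZE s : D s -> z s - z t = (s - t) *: Z s.
  move=> Ds; apply/matrixP => i j; rewrite !mxE mulrC.
  by case: (zetaP (i, j)) => /(_ s Ds).
have Zl : Z @ within D (nbhs t) --> l.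
  apply: cvg_mx => i j; case: (zetaP (i, j)) => _.
  by rewrite (_ : (fun s => Z s i j) = zeta (i, j))//; apply/funext => s; rewrite mxE.
have zc : z @ within D (nbhs t) --> z t.
  by apply: cvg_mx => i j; exact: drv_within_cvg (zl i j).
have bc : b @ within D (nbhs t) --> b t.
  apply/cvgrPdist_le => e e0; set C : R := (p * q)%:R / eta.
  have C0 : 0 < C + 1 by rewrite ltr_wpDl// /C divr_ge0// ltW.
  have /cvgrPdist_le/(_ _ (divr_gt0 e0 C0)) H := zc.
  have H' : \forall s \near t, D s -> `|z t - z s| <= e / (C + 1) by exact: H.
  suff : \forall s \near t, D s -> `|b t - b s| <= e by [].
  apply: filterS H' => s h Ds; have {h} := h Ds; rewrite ler_pdivlMr// => h.
  apply: le_trans (response_lip eta0 (zb t Dt) (zb s Ds)) _.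
  by apply: le_trans h; rewrite mulrC ler_wpM2l// lerDl.
pose u s := eucl_dot (Z s) (b t); pose w s := eucl_dot (Z s) (b t - b s).
have ul : u @ within D (nbhs t) --> eucl_dot l (b t).
  by apply: cvg_dot Zl _; exact: cvg_cst.
have wl : w @ within D (nbhs t) --> (0 : R).
  rewrite (_ : 0 = eucl_dot l (b t - b t)).
    by apply: cvg_dot Zl _; apply: cvgB bc; exact: cvg_cst.
  by rewrite subrr dotC -(scale0r l) dotZl mul0r.
exists (fun s => if s == t then u t else (m s - m t) / (s - t)); split.
  move=> s _; case: eqVneq => [->|st]; first by rewrite !subrr mulr0.
  by rewrite mulfVK// subr_eq0.
apply: (@squeeze_cvgr _ _ _ _ (fun s => u s - `|w s|) (fun s => u s + `|w s|)).
- suff : \forall s \near t, D s -> u s - `|w s| <=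
    (if s == t then u t else (m s - m t) / (s - t)) <= u s + `|w s| by [].
  apply: (@nearW _ (nbhs t)) => s Ds; case: eqVneq => [->|st].
    by rewrite lerDl gerBl normr_ge0.
  have st0 : 0 < `|s - t| by rewrite normr_gt0 subr_eq0.
  have : `|m s - m t - eucl_dot (z s - z t) (b t)| <=
      `|eucl_dot (z s - z t) (b t - b s)|.
    have h := response_value_diff eta0 (zb t Dt) (zb s Ds).
    exact: le_trans h (ler_norm _).
  rewrite ZE// !dotZl -/(u s) -/(w s) normrM.
  have -> : m s - m t - (s - t) * u s = (s - t) * ((m s - m t) / (s - t) - u s).
    by rewrite mulrBr mulrCA divff ?subr_eq0// mulr1.
  by rewrite normrM ler_pM2l// ler_distl.
- rewrite [X in _ --> X](_ : _ = eucl_dot l (b t) - `|0 : R|); last first.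
    by rewrite normr0 subr0.
  by apply: cvgB => //; exact: cvg_norm.
- rewrite [X in _ --> X](_ : _ = eucl_dot l (b t) + `|0 : R|); last first.
    by rewrite normr0 addr0.
  by apply: cvgD => //; exact: cvg_norm.
Qed.

Section Dynamics.
Variables (R : realType) (n m : nat) (G : game R n m) (eta : R).
Hypothesis eta0 : 0 < eta.
Implicit Types (x y : 'M[R]_(n, m)).

Notation "<< x , y >>" := (eucl_dot x y).
Notation F := (marginal_cost G).
Notation br x := (reg_best_response G eta (marginal_cost G x)).

Lemma br_in x : profiles G (br x).
Proof. by case: (reg_best_responseP G eta (F x)). Qed.

Lemma br_lip : exists2 L, 0 <= L & forall x y, profiles G x -> profiles G y ->
  `|br x - br y| <= L * `|x - y|.
Proof.
have [L L0 FL] := marginal_lip G.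
have C0 : 0 <= (n * m)%:R / eta by rewrite divr_ge0// ltW.
exists ((n * m)%:R / eta * L) => [|x y Kx Ky]; first exact: mulr_ge0.
apply: le_trans (response_lip eta0 (reg_best_responseP G eta (F x))
  (reg_best_responseP G eta (F y))) _.
by rewrite -[leRHS]mulrA ler_wpM2l// FL.
Qed.

Lemma FW_solution_exists x0 : profiles G x0 ->
  exists x : R -> 'M[R]_(n, m), FW_solution G eta x /\ x 0 = x0.
Proof.
move=> Kx0; have [L L0 bL] := br_lip; have [B B0 KB] := profiles_bounded G.
have [||||x [xx0 xK xd]] := @flow_exists R 'M[R]_(n, m) (profiles G)
  (FW_field G eta) (L + 1) (B + B) (@profiles_compact _ _ _ G) _ _ _ _ x0 Kx0.
- by move=> y h Ky h01; apply: profiles_segment => //; exact: br_in.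
- by rewrite addr_ge0.
- move=> y z Ky Kz; rewrite /FW_field.
  have -> : br y - y - (br z - z) = (br y - br z) - (y - z).
    by move: (br y) (br z) => u w; rewrite !opprB addrACA [RHS]addrACA [- y - w]addrC.
  by rewrite (le_trans (ler_normB _ _))// mulrDl mul1r lerD2r bL.
- move=> y Ky; rewrite (le_trans (ler_normB _ _))// lerD// KB//; exact: br_in.
- by exists x; split=> // t t0; split=> //; exact: xd.
Qed.

Lemma equilibrium_response x : reg_equilibria G eta x ->
  is_response (profiles G) eta (F x) x.
Proof.
move=> [_ xE]; rewrite [X in is_response _ _ _ X]xE.
exact: reg_best_responseP.
Qed.

(** The regularized duality gap, a Lyapunov function of the dynamics. *)
Definition gap x : R :=
  (<<F x, x>> + eta / 2 * <<x, x>>) - (<<F x, br x>> + eta / 2 * <<br x, br x>>).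

Lemma gap_ge_residual x : profiles G x -> eta / 2 * <<x - br x, x - br x>> <= gap x.
Proof.
move=> Kx; have := response_growth (reg_best_responseP G eta (F x)) Kx.
by rewrite /gap; move=> h; rewrite lerBrDr addrC.
Qed.

Lemma gap_ge0 x : profiles G x -> 0 <= gap x.
Proof.
move=> /gap_ge_residual; apply: le_trans.
by rewrite mulr_ge0 ?dot_ge0// divr_ge0// ltW.
Qed.

Lemma gap_equilibrium x : reg_equilibria G eta x -> gap x = 0.
Proof. by move=> [_ xE]; rewrite /gap -xE subrr. Qed.

(** The gap is the product of x - br x, which vanishes at the equilibrium and is
    Lipschitz, with a bounded factor. *)
Lemma gap_le xs : reg_equilibria G eta xs -> exists2 C, 0 <= C &
  forall x, profiles G x -> gap x <= C * `|x - xs|.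
Proof.
move=> [Ks sE]; have [L L0 bL] := br_lip; have [B B0 KB] := profiles_bounded G.
have [M M0 FM] := marginal_lip G.
set A := `|F xs| + M * (B + B) + eta / 2 * (B + B).
have A0 : 0 <= A by rewrite !addr_ge0// mulr_ge0// ?addr_ge0// divr_ge0// ltW.
exists ((n * m)%:R * (A * (1 + L))) => [|x Kx].
  by rewrite !mulr_ge0// addr_ge0.
have Kb := br_in x.
have -> : gap x = <<F x + (eta / 2) *: (x + br x), x - br x>>.
  by rewrite /gap !dotE (dotC (br x) x); ring.
apply: le_trans (ler_norm _) _; apply: le_trans (norm_dot_le _ _) _.
rewrite -[leRHS]mulrA; apply: ler_wpM2l => //; rewrite -[leRHS]mulrA.
apply: ler_pM => //.
- apply: le_trans (ler_normD _ _) _; apply: lerD.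
    have -> : F x = F xs + (F x - F xs) by rewrite addrC subrK.
    apply: le_trans (ler_normD _ _) _; rewrite lerD2l.
    apply: le_trans (FM _ _ Kx Ks) _; apply: ler_wpM2l => //.
    by rewrite (le_trans (ler_normB _ _))// lerD// KB.
  rewrite normrZ ger0_norm ?divr_ge0// ?(ltW eta0)//.
  apply: ler_wpM2l; first by rewrite divr_ge0// ltW.
  by rewrite (le_trans (ler_normD _ _))// lerD// KB.
- have -> : x - br x = (x - xs) + (br xs - br x) by rewrite -sE addrA subrK.
  rewrite (le_trans (ler_normD _ _))// mulrDl mul1r lerD2l.
  by rewrite (distrC x) bL.
Qed.

Section MonotoneCosts.
Hypothesis n2 : (2 <= n)%N.
Hypothesis costQ : forall e, @class_Q R n (cost G e).

(** Competing with the equilibrium strategy in the gap and using monotonicity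
    of the marginal costs. *)
Lemma gap_ge_dist xs x : reg_equilibria G eta xs -> profiles G x ->
  eta / 2 * <<x - xs, x - xs>> <= gap x.
Proof.
move=> es Kx; have [Ks _] := es; have [_ /(_ x Kx) vi] := equilibrium_response es.
have mono := marginal_monotone n2 costQ Kx Ks.
have := response_growth (reg_best_responseP G eta (F x)) Ks.
have : 0 <= eta / 2 * <<xs - br x, xs - br x>>.
  by rewrite mulr_ge0 ?dot_ge0// divr_ge0// ltW.
move: vi mono; rewrite /gap; move: (br x) => u; move: (F x) (F xs) => v w.
rewrite !dotE !(dotC xs x) !(dotC u xs).
move: <<v, x>> <<v, u>> <<v, xs>> <<w, x>> <<w, xs>> <<x, x>> <<xs, xs>>.
by move: <<x, xs>> <<u, u>> <<xs, u>> => *; lra.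
Qed.

Lemma equilibrium_unique xs x : reg_equilibria G eta xs ->
  reg_equilibria G eta x -> x = xs.
Proof.
move=> es ex; have [Kx _] := ex; have := gap_ge_dist es Kx.
rewrite gap_equilibrium// pmulr_rle0 ?divr_gt0// => /dot_le0_eq0/eqP.
by rewrite subr_eq0 => /eqP.
Qed.

(** Let d = br x - x be the velocity and J d the derivative of the prices.  By
    Danskin's rule the terms of the derivative of the gap containing J d
    combine to - <J d, d>, which is nonpositive by monotonicity; the others,
    <F x + eta x, d>, equal - gap x - eta / 2 * |d|^2.  So the gap decreases at
    least at unit exponential rate, and (1 + t) * gap is nonincreasing. *)
Lemma gap_decay (x : R -> 'M[R]_(n, m)) t : FW_solution G eta x -> 0 <= t ->
  (1 + t) * gap (x t) <= gap (x 0).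
Proof.
move=> sx t0; pose d s := br (x s) - x s.
have xK s : 0 <= s -> profiles G (x s) by move=> /sx[].
have xd s : 0 <= s -> forall i e, drv_within (@Rplus R) (fun u => x u i e) s (d s i e).
  by move=> s0 i e; have [_ h] := sx s s0; exact: has_drv_coord.
pose zd s := marginal_drv G (x s) (d s).
have zdP s : 0 <= s -> forall i e,
    drv_within (@Rplus R) (fun u => F (x u) i e) s (zd s i e).
  move=> s0; apply: marginal_drv_curve => //; last exact: xd.
  by move=> u u0 i e; exact: profiles_ge0 (xK u u0).
have bd s : 0 <= s -> drv_within (@Rplus R)
    (fun u => <<F (x u), br (x u)>> + eta / 2 * <<br (x u), br (x u)>>) s
    <<zd s, br (x s)>>.
  move=> s0; apply: (response_value_drv (K := profiles G)) => //; last exact: zdP.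
  by move=> u u0; exact: reg_best_responseP.
have dotd (f g : R -> 'M[R]_(n, m)) s (f' g' : 'M[R]_(n, m)) :
    (forall i e, drv_within (@Rplus R) (fun u => f u i e) s (f' i e)) ->
    (forall i e, drv_within (@Rplus R) (fun u => g u i e) s (g' i e)) ->
    drv_within (@Rplus R) (fun u => <<f u, g u>>) s (<<f', g s>> + <<f s, g'>>).
  move=> df dg; rewrite /eucl_dot -big_split/=; apply: drv_within_sum => i.
  by rewrite -big_split/=; apply: drv_within_sum => e; exact: drv_withinM.
pose gd s := <<zd s, x s>> + <<F (x s), d s>> +
  eta / 2 * (eucl_dot (d s) (x s) + eucl_dot (x s) (d s)) - <<zd s, br (x s)>>.
have gapd s : 0 <= s -> drv_within (@Rplus R) (fun u => gap (x u)) s (gd s).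
  move=> s0; apply: drv_withinB; last exact: bd.
  apply: drv_withinD; first by apply: dotd; [exact: zdP | exact: xd].
  by apply: drv_withinZ; apply: dotd; exact: xd.
have gd_le s : 0 <= s -> gd s <= - gap (x s).
  move=> s0; have x0 i e : 0 <= x s i e by exact: profiles_ge0 (xK s s0).
  have h1 := marginal_drv_ge0 n2 costQ (d s) x0.
  have h2 := mulr_ge0 (ltW eta0) (dot_ge0 (d s)).
  move: h1 h2; rewrite -/(zd s) /gd /gap /d !dotE !(dotC (br (x s)) (x s)).
  move: (x s) (br (x s)) (zd s) (F (x s)) => u w v f.
  by move: <<v, u>> <<v, w>> <<f, u>> <<f, w>> <<u, u>> <<u, w>> <<w, w>> => *; lra.
suff : (1 + t) * gap (x t) <= (1 + 0) * gap (x 0) by rewrite addr0 mul1r.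
apply: (@drv_within_le0_ge R 0 t (@Rplus R) (fun s => (1 + s) * gap (x s))
  (fun s => 1 * gap (x s) + (1 + s) * gd s) t0).
- by move=> s; rewrite /= in_itv/= => /andP[].
- move=> s /andP[s0 _]; apply: drv_withinM; last exact: gapd.
  have := drv_withinD (drv_within_cst (@Rplus R) 1 s) (drv_within_id (@Rplus R) s).
  by rewrite add0r.
- move=> s /andP[s0 _]; have := gd_le s s0; have := gap_ge0 (xK s s0).
  by move: (gd s) (gap (x s)) => g V *; nra.
Qed.


(** The continuous residual attains its minimum on the compact set of profiles;
    the minimum is 0, because the residual is dominated by the gap, which tends
    to 0 along any trajectory. *)
Lemma equilibrium_exists : reg_equilibria G eta !=set0.
Proof.
have [L L0 bL] := br_lip.
have [xm Km xmin] : exists2 xm, xm \in profiles G & forall x, x \in profiles G ->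
    `|xm - br xm| <= `|x - br x|.
  apply: (@compact_EVT_min _ R (fun x => `|x - br x|)).
  - exact: profiles_nonempty.
  - exact: profiles_compact.
  - apply/subspace_continuousP => x Kx; apply: cvg_norm; apply: cvgB.
      by apply: cvg_within_filter; exact: cvg_id.
    apply/cvgrPdist_le => e e0; have L1 : 0 < L + 1 by rewrite ltr_wpDl.
    suff : \forall y \near x, profiles G y -> `|br x - br y| <= e by [].
    near=> y; move=> Ky; apply: le_trans (bL _ _ Kx Ky) _.
    apply: (@le_trans _ _ ((L + 1) * `|x - y|)).
      by rewrite ler_wpM2r// lerDl.
    rewrite -ler_pdivlMl// mulrC; near: y.
    by apply: (@cvgr_dist_le _ _ _ (nbhs x) _ id x); [exact: cvg_id | rewrite divr_gt0].
move: Km => /set_mem Km; have [x [sx x0]] := FW_solution_exists Km.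
suff r0 : `|xm - br xm| = 0.
  exists xm; split=> //; apply/eqP; rewrite -subr_eq0 -normr_eq0; exact/eqP.
apply/eqP; rewrite -sqrf_eq0 eq_le sqr_ge0 andbT.
set r := `|xm - br xm| ^+ 2; have V0 := gap_ge0 Km.
have rt t : 0 <= t -> (1 + t) * (eta / 2 * r) <= gap xm.
  move=> t0; have [Kxt _] := sx t t0; have := gap_decay sx t0; rewrite x0.
  apply: le_trans; apply: ler_wpM2l; first by rewrite addr_ge0.
  apply: le_trans (gap_ge_residual Kxt); apply: ler_wpM2l.
    by rewrite divr_ge0// ltW.
  apply: le_trans (norm_sqr_le_dot _).
  have h := xmin _ (mem_set Kxt).
  exact: sqr_homo (normr_ge0 _) h.
rewrite leNgt; apply/negP => rp.
have c0 : 0 < eta / 2 * r by rewrite mulr_gt0// divr_gt0.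
have := rt (gap xm / (eta / 2 * r)); rewrite divr_ge0// ?(ltW c0)// => /(_ isT).
by rewrite mulrDl mul1r mulfVK ?gt_eqF// gerDr leNgt c0.
Unshelve. all: by end_near. Qed.

Lemma solution_dist xs (x : R -> 'M[R]_(n, m)) t : reg_equilibria G eta xs ->
  FW_solution G eta x -> 0 <= t ->
  (1 + t) * (eta / 2 * enorm (x t - xs) ^+ 2) <= gap (x 0).
Proof.
move=> es sx t0; have [Kxt _] := sx t t0.
apply: le_trans (gap_decay sx t0); apply: ler_wpM2l; first by rewrite addr_ge0.
by rewrite enorm_sqr; exact: gap_ge_dist.
Qed.

Lemma solution_stable xs eps : reg_equilibria G eta xs -> 0 < eps ->
  exists2 delta, 0 < delta & forall x : R -> 'M[R]_(n, m),
    FW_solution G eta x -> `|x 0 - xs| <= delta ->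
    forall t, 0 <= t -> enorm (x t - xs) <= eps.
Proof.
move=> es e0; have [C C0 CP] := gap_le es.
have C1 : 0 < C + 1 by rewrite ltr_wpDl.
have e2 : 0 < eta / 2 * eps ^+ 2 by rewrite mulr_gt0 ?divr_gt0 ?exprn_gt0.
exists (eta / 2 * eps ^+ 2 / (C + 1)) => [|x sx xd t t0]; first exact: divr_gt0.
have [K0 _] := sx 0 (lexx _).
rewrite -(@ler_pXn2r _ 2)// ?nnegrE ?sqrtr_ge0// ?(ltW e0)//.
rewrite -(ler_pM2l (_ : 0 < eta / 2)) ?divr_gt0//.
have h := solution_dist es sx t0.
apply: (@le_trans _ _ (gap (x 0))).
  apply: le_trans h; rewrite ler_peMl ?lerDl//.
  by rewrite mulr_ge0 ?sqr_ge0// divr_ge0// ltW.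
apply: le_trans (CP _ K0) _; move: xd; rewrite ler_pdivlMr// => xd.
by apply: le_trans xd; rewrite mulrC ler_wpM2l// lerDl.
Qed.

Lemma equilibria_singleton xs : reg_equilibria G eta xs ->
  reg_equilibria G eta = [set xs].
Proof.
move=> es; apply/seteqP; split=> [y|y ->//]; exact: equilibrium_unique.
Qed.

(** Along a solution the gap bounds the squared distance to the equilibrium
    from above and decays at a uniform rate; near the equilibrium it is small. *)
Lemma Q_globally_stable :
  globally_asymptotically_stable G eta (reg_equilibria G eta).
Proof.
have [xs es] := equilibrium_exists.
rewrite (equilibria_singleton es); split=> [eps e0|x0 K0].
  have [d d0 dP] := solution_stable es e0.
  exists d => // x sx; rewrite edist_to_singleton lee_fin => xd t t0.
  rewrite edist_to_singleton lee_fin; apply: dP => //.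
  exact: le_trans (norm_le_enorm _) xd.
split; first exact: FW_solution_exists.
move=> x sx xx0; under eq_fun do rewrite edist_to_singleton.
apply: cvg_EFin; first by near=> t.
apply/cvgrPdist_le => e e0; near=> t.
have t0 : 0 <= t by near: t; exact: nbhs_pinfty_ge.
rewrite /= sub0r normrN ger0_norm ?sqrtr_ge0//.
rewrite -(@ler_pXn2r _ 2)// ?nnegrE ?sqrtr_ge0// ?(ltW e0)//.
have h := solution_dist es sx t0; rewrite xx0 in h.
have t1 : 0 < 1 + t by rewrite ltr_wpDr.
have c0 : 0 < eta / 2 by rewrite divr_gt0.
rewrite -(ler_pM2l c0) -(ler_pM2l t1); apply: (le_trans h).
have ce : 0 < eta / 2 * e ^+ 2 by rewrite mulr_gt0// exprn_gt0.
rewrite -ler_pdivrMr//; apply: (@le_trans _ _ t); last by rewrite lerDr.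
by near: t; apply: nbhs_pinfty_ge; exact: num_real.
Unshelve. all: by end_near. Qed.

Lemma Q_locally_stable xs : reg_equilibria G eta xs ->
  locally_Lyapunov_stable G eta xs.
Proof.
move=> es U [UK]; rewrite /within /= => /nbhs_ballP[e /= e0 eU].
have e2 : 0 < e / 2 by rewrite divr_gt0.
have [d d0 dP] := solution_stable es e2.
exists (U `&` [set y | `|y - xs| <= d]); split.
- split=> [y [/UK]//|]; rewrite /within /=.
  near=> y; move=> Ky; split.
    apply: eU Ky; near: y; exact: nbhsx_ballx.
  rewrite /= distrC; near: y.
  by apply: (@cvgr_dist_le _ _ _ (nbhs xs) _ id xs); [exact: cvg_id |].
- by move=> y [].
- move=> x sx [_ /= xd] t t0; have [Kxt _] := sx t t0.
  apply: eU Kxt; rewrite -ball_normE /ball_/= distrC.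
  apply: le_lt_trans (norm_le_enorm _) _; apply: le_lt_trans (dP x sx xd t t0) _.
  by rewrite ltr_pdivrMr// ltr_pMr// ltr1n.
Unshelve. all: by end_near. Qed.

End MonotoneCosts.
End Dynamics.

(** * Instability when the marginal condition fails *)

Section TwoLevelMatrices.
Variables (R : realType) (n : nat).
Hypothesis n2 : (2 <= n)%N.

Lemma sum_one_other (i : 'I_n) (u w : R) :
  \sum_(e < n) (if i == e then u else w) = u + (n%:R - 1) * w.
Proof.
rewrite (bigD1 i)//= eqxx; congr (_ + _).
rewrite (eq_bigr (fun=> w)) => [|e /negbTE]; last by rewrite eq_sym => ->.
rewrite sumr_const cardC1 card_ord -[LHS]mulr_natl; congr (_ * _).
by case: (n) n2 => // k _; rewrite -natr1 addrK.
Qed.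

(** The matrices invariant under simultaneous relabelling of players and
    resources. *)
Definition two_level (u w : R) : 'M[R]_n := \matrix_(i, e) if i == e then u else w.

Lemma load_two_level u w e : load (two_level u w) e = u + (n%:R - 1) * w.
Proof.
rewrite /load -(sum_one_other e); apply: eq_bigr => i _.
by rewrite mxE eq_sym.
Qed.

Lemma dot_row_two_level u w u' w' i :
  eucl_dot (row i (two_level u w)) (row i (two_level u' w')) =
  u * u' + (n%:R - 1) * (w * w').
Proof.
rewrite /eucl_dot big_ord1 -(sum_one_other i); apply: eq_bigr => e _.
by rewrite !mxE; case: eqP.
Qed.

Lemma two_levelD u w u' w' :
  two_level u w + two_level u' w' = two_level (u + u') (w + w').
Proof. by apply/matrixP => i e; rewrite !mxE; case: eqP. Qed.

Lemma two_levelZ a u w : a *: two_level u w = two_level (a * u) (a * w).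
Proof. by apply/matrixP => i e; rewrite !mxE; case: eqP. Qed.

End TwoLevelMatrices.

(** A scalar trajectory repelled from 0 while it stays in [- r, r] must exit:
    its square increases at a rate bounded away from 0. *)
Lemma repelled_exit (R : realType) (T B : R -> R) (r t0 : R) :
  0 < t0 -> t0 <= r -> T 0 = t0 ->
  (forall t, 0 <= t -> drv_within (@Rplus R) T t (B (T t) - T t)) ->
  (forall u, `|u| <= r -> u ^+ 2 <= u * (B u - u)) ->
  exists2 t, 0 <= t & `|T t| = r.
Proof.
move=> t00 t0r T0 Td rep; apply: contrapT => noexit.
have r0 : 0 < r := lt_le_trans t00 t0r.
pose S t := T t * T t.
pose dS t := (B (T t) - T t) * T t + T t * (B (T t) - T t).
have Sd t : 0 <= t -> drv_within (@Rplus R) S t (dS t).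
  by move=> tt; apply: drv_withinM; exact: Td.
have sub0 t : `[0, t]%classic `<=` @Rplus R.
  by move=> u; rewrite /= in_itv/= => /andP[].
have S_lt t : 0 <= t -> S t < r ^+ 2.
  move=> tt; rewrite ltNge; apply/negP => rS.
  have [||c] := @IVT R S 0 t (r ^+ 2) tt.
  - apply/subspace_continuousP => u ut.
    by apply: drv_within_cvg (drv_within_sub (@sub0 t) (Sd u _)); exact: sub0 ut.
  - apply/andP; split.
      by rewrite ge_min /S T0 -expr2 sqr_homo// ltW.
    by rewrite le_max rS orbT.
  - rewrite in_itv/= => /andP[c0 _] Sc; apply: noexit; exists c => //.
    apply/eqP; rewrite -(@eqrXn2 _ 2)// ?(ltW r0)// real_normK ?num_real//.
    by rewrite expr2 -/(S c) Sc.
have Tr t : 0 <= t -> `|T t| <= r.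
  move=> /S_lt/ltW St; apply: sqr_homo_inv; first exact: ltW.
  by rewrite real_normK ?num_real// expr2.
have dS_ge t : 0 <= t -> 2 * S t <= dS t.
  move=> /Tr/rep; rewrite /dS /S expr2; move: (T t) (B _) => u b h; lra.
have S0 : S 0 = t0 ^+ 2 by rewrite /S T0 expr2.
have S_ge t : 0 <= t -> t0 ^+ 2 <= S t.
  move=> tt; rewrite -S0; apply: (drv_within_ge0_le tt (@sub0 t)).
    by move=> u /andP[u0 _]; exact: Sd.
  move=> u /andP[u0 _]; apply: le_trans (dS_ge u u0).
  by rewrite mulr_ge0// /S -expr2 sqr_ge0.
have c0 : 0 < 2 * t0 ^+ 2 by rewrite mulr_gt0// exprn_gt0.
pose t1 := r ^+ 2 / (2 * t0 ^+ 2).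
have t10 : 0 <= t1 by rewrite divr_ge0 ?sqr_ge0// ltW.
have := S_lt t1 t10; apply/negP; rewrite -leNgt.
have : S 0 - 2 * t0 ^+ 2 * 0 <= S t1 - 2 * t0 ^+ 2 * t1.
  apply: (@drv_within_ge0_le R 0 t1 (@Rplus R) (fun t => S t - 2 * t0 ^+ 2 * t)
    (fun t => dS t - 2 * t0 ^+ 2 * 1) t10 (@sub0 t1)).
    move=> u /andP[u0 _]; apply: drv_withinB; first exact: Sd.
    exact/drv_withinZ/drv_within_id.
  move=> u /andP[u0 _]; rewrite mulr1 subr_ge0; apply: le_trans (dS_ge u u0).
  by rewrite ler_pM2l// S_ge.
rewrite /t1 [X in _ <= _ - X]mulrC mulfVK ?gt_eqF// mulr0 subr0 lerBrDl S0.
by apply: le_trans; rewrite lerDl sqr_ge0.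
Qed.

(** Where the marginal condition fails strictly, it still fails after a small
    amount q of the load is moved from each player's own resource to the
    others, which leaves room for deviations in both directions. *)
Lemma violation_split (R : realType) (N g A B s : R) :
  0 < N -> 0 <= g -> 0 <= A -> 0 < s -> g * A - s * B < 0 ->
  exists p q a, [/\ 0 < p, 0 < q, 0 < a, p + N * q = s &
    g * A - (p - 2 * q) * B = - a].
Proof.
move=> N0 g0 A0 s0 bad; have gA : 0 <= g * A by exact: mulr_ge0.
have sB : 0 < s * B by lra.
have B0 : 0 < B by move: sB; rewrite pmulr_rgt0.
have N2 : 0 < 2 * (N + 2) by rewrite mulr_gt0// addr_gt0.
pose q := (s * B - g * A) / (2 * (N + 2) * B).
have q0 : 0 < q by rewrite divr_gt0 ?mulr_gt0//; lra.
have qE : q * (2 * (N + 2) * B) = s * B - g * A.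
  by rewrite /q mulfVK// gt_eqF// mulr_gt0.
have qs : q * (2 * (N + 2)) <= s.
  rewrite -(ler_pM2r B0) -mulrA qE; lra.
exists (s - N * q), q, ((s * B - g * A) / 2); split => //.
- have : 0 < q * (N + 4) by rewrite mulr_gt0// addr_gt0.
  nra.
- by rewrite divr_gt0//; lra.
- by rewrite subrK.
- by move: qE; clear; move: q => q qE; lra.
Qed.

Section UnstableGame.
Variables (R : realType) (n : nat) (c : R -> R) (s p q a : R).
Hypothesis n2 : (2 <= n)%N.
Hypothesis cD : class_D c.
Hypothesis p0 : 0 < p.
Hypothesis q0 : 0 < q.
Hypothesis a0 : 0 < a.
Hypothesis pqs : p + (n%:R - 1) * q = s.
Hypothesis slope :
  gamma_n R n * drv c s - (p - 2 * q) * drv (drv c) s = - a.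

Let N : R := n%:R - 1.
Let N0 : 0 < N. Proof. by rewrite subr_gt0 ltr1n. Qed.

(** Each player moves by one unit on the own resource and by - dl on the
    n - 1 others: the direction for which Cauchy-Schwarz is an equality in
    marginal_form_ge0.  Its squared length E satisfies gamma_n = 1 + E. *)
Let dl : R := 2 / N.
Let E : R := 1 + 2 * dl.
(* With this eta the symmetric best response to X t is about X (4 * t) for
   small t, which leaves a factor 2 of margin over the repulsion needed. *)
Let eta : R := a / (4 * E).
Let kappa : R := p - 2 * q.
(* Chosen to make X 0 an equilibrium: the entries of a player's direction sum
   to - 1, so an additive constant shifts the first-order condition. *)
Let b : R := kappa * (drv c s + eta) - c s.
Let cb (x : R) : R := 1 * c x + b.
(* On |t| <= tau all entries of X t are nonnegative. *)
Let tau : R := Num.min p (q / dl).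
Let X (t : R) : 'M[R]_n := two_level n (p + t) (q - dl * t).
Let Dm : 'M[R]_n := two_level n 1 (- dl).

Let Ndl : N * dl = 2. Proof. by rewrite /dl mulrC mulfVK ?gt_eqF. Qed.
Let dl0 : 0 < dl. Proof. by rewrite divr_gt0. Qed.
Let E0 : 0 < E. Proof. by rewrite /E addr_gt0// mulr_gt0. Qed.
Let eta0 : 0 < eta. Proof. by rewrite divr_gt0// mulr_gt0. Qed.
Let tau0 : 0 < tau. Proof. by rewrite lt_min p0 divr_gt0. Qed.

Let gammaE : gamma_n R n = 1 + E.
Proof.
rewrite /gamma_n -/N; apply: (mulIf (lt0r_neq0 N0)); rewrite mulfVK ?gt_eqF//.
have -> : (1 + E) * N = 2 * N + 2 * (N * dl) by rewrite /E; ring.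
by rewrite Ndl /N; ring.
Qed.

Let cbD : class_D cb. Proof. by case: (class_D_affine b ltr01 cD). Qed.

Let drv_cb x : 0 <= x -> drv cb x = drv c x.
Proof. by move=> x0; case: (class_D_affine b ltr01 cD) => _ -> //; rewrite mul1r. Qed.

Let XB t u : X t - X u = (t - u) *: Dm.
Proof.
rewrite /X /Dm -(scaleN1r (two_level _ _ _)) !two_levelZ two_levelD.
by congr (two_level n _ _); ring.
Qed.

Let X_ge0 t i e : `|t| <= tau -> 0 <= X t i e.
Proof.
rewrite le_min => /andP[tp tq]; rewrite mxE; case: eqP => _.
  by move: tp; rewrite ler_norml => /andP[]; lra.
move: tq; rewrite ler_pdivlMr// => tq; rewrite subr_ge0 (le_trans _ tq)//.
by rewrite mulrC ler_wpM2r ?ler_norm// ltW.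
Qed.

Let line (i : 'I_n) : set 'rV[R]_n := (fun t => row i (X t)) @` `[- tau, tau]%classic.

Let lineP i t : `|t| <= tau -> line i (row i (X t)).
Proof. by move=> tt; exists t => //; rewrite /= in_itv/= -ler_norml. Qed.

Let lineE i y : line i y -> exists2 t, `|t| <= tau & y = row i (X t).
Proof.
by move=> [t]; rewrite /= in_itv/= -ler_norml => tt <-; exists t.
Qed.

Let line_ge0 i y : line i y -> forall e, 0 <= y ord0 e.
Proof. by move=> /lineE[t tt ->] e; rewrite mxE; exact: X_ge0. Qed.

Let line_nonempty i : line i !=set0.
Proof. by exists (row i (X 0)); apply: lineP; rewrite normr0 ltW. Qed.

Let line_convex i : @convex_set R 'rV[R]_n (line i).
Proof.
move=> x y l /set_mem/lineE[t tt ->] /set_mem/lineE[u uu ->]; apply/mem_set.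
have l0 : 0 <= l%:num by []. have l1 : l%:num <= 1 by [].
pose k : R := l%:num; have k0 : 0 <= k := l0; have k1 : k <= 1 := l1.
suff : line i (k *: row i (X t) + (1 - k) *: row i (X u)) by [].
clearbody k; clear l l0 l1.
rewrite (_ : _ + _ = row i (X (k * t + (1 - k) * u))).
  apply: lineP; apply: le_trans (ler_normD _ _) _; rewrite !normrM.
  rewrite (ger0_norm k0) (ger0_norm (_ : 0 <= 1 - k)) ?subr_ge0//.
  have := ler_wpM2l k0 tt.
  have := @ler_wpM2l _ (1 - k) _ _ _ uu; rewrite subr_ge0 => /(_ k1).
  lra.
by apply/rowP => e; rewrite !mxE; case: eqP => _; ring.
Qed.

Let line_compact i : compact (line i).
Proof.
apply: continuous_compact; last exact: segment_compact.
apply: continuous_subspaceT => t; apply: cvg_mx => k e; rewrite mxE.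
rewrite (_ : (fun u => row i (X u) k e) = fun u => X 0 i e + u * Dm i e).
  rewrite (_ : X t i e = X 0 i e + t * Dm i e).
    apply: cvgD; first exact: cvg_cst.
    by apply: cvgM; [exact: cvg_id | exact: cvg_cst].
  by rewrite !mxE; case: eqP => _; ring.
by apply/funext => u; rewrite !mxE; case: eqP => _; ring.
Qed.

Definition line_game : game R n n :=
  Game line_ge0 line_nonempty line_convex line_compact (fun=> cbD).


Let Xp t : `|t| <= tau -> profiles line_game (X t).
Proof. by move=> tt i; exact: lineP. Qed.

Let load_X t e : load (X t) e = s - t.
Proof.
rewrite (load_two_level n2) -pqs -/N mulrBr mulrA Ndl; ring.
Qed.

Let st0 t : `|t| <= tau -> 0 <= s - t.
Proof.
rewrite le_min => /andP[tp _]; have := mulr_gt0 N0 q0; have := ler_norm t.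
rewrite -pqs -/N; lra.
Qed.

Let fown t := cb (s - t) + (p + t) * drv cb (s - t).
Let foth t := cb (s - t) + (q - dl * t) * drv cb (s - t).

Let marginal_X t : marginal_cost line_game (X t) = two_level n (fown t) (foth t).
Proof.
by apply/matrixP => i e; rewrite !mxE load_X; case: eqP.
Qed.

(** At the profile X t the regularized objective of a player, as a function of
    the own position u on the line, has derivative h t + eta * E * u; its
    minimizer over [- tau, tau] is the clipped value B t. *)
Let h t := fown t - 2 * foth t + eta * kappa.
Let B t := Num.max (- tau) (Num.min tau (- h t / (eta * E))).

Let B_tau t : `|B t| <= tau.
Proof.
have tn : - tau <= tau by rewrite ge0_cp// ltW.
by rewrite ler_norml le_max lexx/= ge_max tn ge_min lexx.
Qed.

Let clip_vi (z u : R) : `|u| <= tau ->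
  0 <= (u - Num.max (- tau) (Num.min tau z)) *
       (Num.max (- tau) (Num.min tau z) - z).
Proof.
rewrite ler_norml => /andP[u1 u2]; have t0 := tau0.
case: (leP tau z) => tz.
  have -> : Num.max (- tau) tau = tau by apply/max_idPr; lra.
  by rewrite -mulrNN mulr_ge0//; lra.
case: (leP (- tau) z) => zt; first by rewrite subrr mulr0.
by rewrite mulr_ge0//; lra.
Qed.

Let response_X t : `|t| <= tau ->
  reg_best_response line_game eta (marginal_cost line_game (X t)) = X (B t).
Proof.
move=> tt; apply: (reg_best_response_unique eta0); split; first exact: Xp.
move=> y Ky; rewrite dot_row; apply: sumr_ge0 => i _.
have [u uu yE] := lineE (Ky i).
have -> : row i (y - X (B t)) = row i (X u - X (B t)).
  by apply/rowP => e; move/rowP: yE => /(_ e); rewrite !mxE => ->.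
rewrite XB /Dm two_levelZ.
rewrite marginal_X two_levelZ two_levelD (dot_row_two_level n2) -/N.
have := clip_vi (- h t / (eta * E)) uu; rewrite -/(B t) => vi.
have eE : 0 < eta * E by rewrite mulr_gt0.
have zE : eta * E * (- h t / (eta * E)) = - h t by rewrite mulrC mulfVK ?gt_eqF.
have := mulr_ge0 (ltW eE) vi; congr (_ <= _).
move: zE; move: (- h t / (eta * E)) => z zE.
transitivity ((u - B t) * (eta * E * B t - eta * E * z)); first by ring.
rewrite zE /h /kappa /E.
transitivity ((u - B t) * (fown t + eta * (p + B t)) -
  (N * dl) * ((foth t + eta * (q - dl * B t)) * (u - B t))); last by ring.
by rewrite Ndl; ring.
Qed.

Let h0 : h 0 = 0.
Proof.
rewrite /h /fown /foth /cb /b subr0 drv_cb ?(ltW _)//; last first.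
  by rewrite -pqs addr_gt0// mulr_gt0.
by rewrite /kappa; ring.
Qed.

(** The derivative of h at 0 is gamma_n c'(s) - kappa c''(s), the quantity whose
    sign decides stability. *)
Let h_drv : drv_within [set t | 0 <= s - t] h 0 (- a).
Proof.
have s0 : 0 <= s - 0 by apply: st0; rewrite normr0 ltW.
have sd : drv_within [set t | 0 <= s - t] (fun t => s - t) 0 (0 - 1).
  by apply: drv_withinB; [exact: drv_within_cst | exact: drv_within_id].
have D0 : forall t, [set t | 0 <= s - t] t -> Rplus (s - t) by [].
have d1 := drv_within_comp D0 (class_D_drv cbD s0) sd.
have d2 := drv_within_comp D0 (class_D_drv2 cbD s0) sd.
have dp := drv_withinD (drv_within_cst [set t | 0 <= s - t] p 0)
  (drv_within_id [set t | 0 <= s - t] 0).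
have dq := drv_withinB (drv_within_cst [set t | 0 <= s - t] q 0)
  (drv_withinZ dl (drv_within_id [set t | 0 <= s - t] 0)).
have dh := drv_withinD (drv_withinB (drv_withinD d1 (drv_withinM dp d2))
  (drv_withinZ 2 (drv_withinD d1 (drv_withinM dq d2))))
  (drv_within_cst [set t | 0 <= s - t] (eta * kappa) 0).
move: dh; congr drv_within.
have [_ _ ggE] := class_D_affine b ltr01 cD.
rewrite drv_cb// ggE// mul1r -slope gammaE subr0 /E; ring.
Qed.

Let rep_radius : exists r, [/\ 0 < r, 2 * r <= tau &
  forall u, `|u| <= r -> u ^+ 2 <= u * (B u - u)].
Proof.
have [f [fE fa]] := h_drv.
have H : \forall t \near (0 : R), 0 <= s - t -> `|- a - f t| <= a / 2.
  by have /cvgrPdist_le/(_ (a / 2)) := fa; apply; rewrite divr_gt0.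
have [e /= e0 eH] := (nbhs_ballP _ _).1 H.
exists (Num.min (e / 2) (tau / 2)); split.
- by rewrite lt_min !divr_gt0.
- by rewrite mulrC -ler_pdivlMr// ge_min lexx orbT.
move=> u; rewrite le_min => /andP[ue ut].
have ut' : `|u| <= tau by apply: le_trans ut _; rewrite ler_pdivrMr// ler_pMr// ler1n.
have fu : f u <= - (a / 2).
  have : `|- a - f u| <= a / 2.
    apply: eH; last exact: st0.
    rewrite /ball/= sub0r normrN; apply: le_lt_trans ue _.
    by rewrite ltr_pdivrMr// ltr_pMr// ltr1n.
  by rewrite ler_norml => /andP[]; lra.
have hu : h u = f u * u.
  by have := fE u (st0 ut'); rewrite h0 !subr0.
have eE : eta * E = a / 4.
  by rewrite /eta; field; rewrite gt_eqF.
rewrite /B hu eE; set z := - _ / _.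
have zE : z = - (f u) * 4 / a * u by rewrite /z; field; rewrite gt_eqF.
have k2 : 2 <= - (f u) * 4 / a by rewrite ler_pdivlMr//; lra.
move: zE k2; move: (- f u * 4 / a) => k zE k2.
have [u0|u0|->] := ltgtP u 0; last by rewrite expr2 !mul0r.
- have uk : z <= 2 * u by rewrite zE; nra.
  have : Num.max (- tau) (Num.min tau z) <= 2 * u.
    rewrite ge_max (_ : - tau <= _)/=; last by move: ut; rewrite ltr0_norm//; lra.
    by rewrite ge_min uk orbT.
  by move: (Num.max _ _) => w wu; nra.
- have uk : 2 * u <= z by rewrite zE; nra.
  have : 2 * u <= Num.max (- tau) (Num.min tau z).
    rewrite le_max le_min uk andbT (_ : 2 * u <= tau) ?orbT//.
    by move: ut; rewrite gtr0_norm//; lra.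
  by move: (Num.max _ _) => w wu; nra.
Qed.


Let i0 : 'I_n := Ordinal (leq_trans (isT : (0 < 2)%N) n2).

Let norm_Dm t : `|t| <= `|t *: Dm|.
Proof.
by have := mx_norm_entry (t *: Dm) i0 i0; rewrite !mxE eqxx mulr1.
Qed.

Let B_lip : exists2 L, 0 <= L & forall t u, `|t| <= tau -> `|u| <= tau ->
  `|B t - B u| <= L * `|t - u|.
Proof.
have [L L0 bL] := br_lip line_game eta0.
exists (L * `|Dm|) => [|t u tt uu]; first exact: mulr_ge0.
apply: le_trans (norm_Dm _) _; rewrite -XB -!response_X//.
by apply: le_trans (bL _ _ (Xp tt) (Xp uu)) _; rewrite XB normrZ mulrA mulrAC.
Qed.

Let line_flow t0 : `|t0| <= tau -> exists T : R -> R,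
  [/\ T 0 = t0, forall t, `|T t| <= tau &
      forall t, 0 <= t -> has_drv (T : R -> R^o) t (B (T t) - T t)].
Proof.
move=> t0t; have [L L0 BL] := B_lip.
have inK t : `[- tau, tau]%classic t <-> `|t| <= tau.
  by rewrite /= in_itv/= -ler_norml.
have [||||T [T0 TK Td]] := @flow_exists R (R^o : normedModType R)
  `[- tau, tau]%classic (fun t => B t - t) (L + 1) (tau + tau)
  (@segment_compact R _ _) _ _ _ _ t0 ((inK t0).2 t0t).
- move=> t k /inK; have := B_tau t; rewrite !ler_norml => /andP[b1 b2] /andP[t1 t2].
  move=> /andP[k0 k1]; apply/inK; rewrite ler_norml.
  suff : - tau <= t + k * (B t - t) <= tau by [].
  by apply/andP; split; nra.
- by rewrite addr_ge0.
- move=> t u /inK tt /inK uu.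
  have -> : B t - t - (B u - u) = (B t - B u) - (t - u) by ring.
  by rewrite (le_trans (ler_normB _ _))// mulrDl mul1r lerD2r BL.
- by move=> t /inK tt; rewrite (le_trans (ler_normB _ _))// lerD// B_tau.
- by exists T; split=> // t; apply/inK.
Qed.

Let line_solution (T : R -> R) : (forall t, `|T t| <= tau) ->
  (forall t, 0 <= t -> has_drv (T : R -> R^o) t (B (T t) - T t)) ->
  FW_solution line_game eta (fun t => X (T t)).
Proof.
move=> Tt Td t t_ge0; split; first exact: Xp.
rewrite /FW_field response_X// XB /has_drv.
rewrite (_ : diff_quot _ t = fun u => diff_quot (T : R -> R^o) t u *: Dm).
  by apply: cvgZ; [exact: Td | exact: cvg_cst].
by apply/funext => u; rewrite /diff_quot XB scalerA.
Qed.

(** From any neighbourhood of the symmetric equilibrium, some trajectory on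
    the line reaches a profile whose residual is bounded below; such a profile
    is at a definite distance from every equilibrium. *)
Lemma line_game_unstable : exists (eta : R) (G : game R n n) (xs : 'M[R]_n) (eps : R),
  [/\ 0 < eta, (forall e, exists b, cost G e = fun x => 1 * c x + b),
      reg_equilibria G eta xs, 0 < eps &
      forall delta, 0 < delta -> exists x : R -> 'M[R]_n,
        [/\ FW_solution G eta x, enorm (x 0 - xs) <= delta &
            exists2 t, 0 <= t & forall y, reg_equilibria G eta y ->
              eps <= `|x t - y|]].
Proof.
have [L L0 bL] := br_lip line_game eta0.
have [r [r0 r2 rep]] := rep_radius.
have L1 : 0 < L + 1 by rewrite ltr_wpDl.
have rt : r <= tau by lra.
have t00 : `|0 : R| <= tau by rewrite normr0 ltW.
exists eta, line_game, (X 0), (r / (L + 1)); split => //.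
- by move=> e; exists b.
- split; first exact: Xp.
  rewrite response_X// /B h0 oppr0 mul0r; congr (X _).
  by rewrite min_r ?(ltW tau0)// max_r// oppr_le0 ltW.
- exact: divr_gt0.
move=> d d0; pose C := enorm Dm + 1.
have C0 : 0 < C by rewrite ltr_wpDl// sqrtr_ge0.
pose t0 := Num.min r (d / C).
have t0p : 0 < t0 by rewrite lt_min r0 divr_gt0.
have t0r : t0 <= r by rewrite ge_min lexx.
have [|T [T0 Tt Td]] := @line_flow t0; first by rewrite gtr0_norm// (le_trans t0r).
have sol := line_solution Tt Td.
exists (fun t => X (T t)); split => //.
  rewrite T0 XB subr0; apply: sqr_homo_inv; first exact: ltW.
  rewrite enorm_sqr dotZl dotZr mulrA -enorm_sqr -expr2 -exprMn.
  apply: sqr_homo; first by rewrite mulr_ge0 ?sqrtr_ge0// ltW.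
  apply: (@le_trans _ _ (t0 * C)); first by rewrite ler_pM2l// lerDl.
  by rewrite -ler_pdivlMr// ge_min lexx orbT.
have [|t t_ge0 Tr] := repelled_exit t0p t0r T0 _ rep.
  by move=> t t_ge0; apply: drv_within_has_drv => //; exact: Td.
exists t => // y ey; have [Ky yE] := ey.
have KX := Xp (Tt t).
rewrite ler_pdivrMr// mulrDr mulr1.
have step : r <= `|X (B (T t)) - X (T t)|.
  rewrite XB; apply: le_trans (norm_Dm _).
  have hh := rep (T t); rewrite Tr lexx in hh; have {}hh := hh isT.
  have Tn : 0 < `|T t| by rewrite Tr.
  rewrite -{1}Tr -(ler_pM2l Tn) -expr2 real_normK ?num_real// -normrM.
  exact: le_trans hh (ler_norm _).
apply: le_trans step _; rewrite -response_X//.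
have -> : reg_best_response line_game eta (marginal_cost line_game (X (T t))) -
    X (T t) = (reg_best_response line_game eta (marginal_cost line_game (X (T t))) -
    reg_best_response line_game eta (marginal_cost line_game y)) - (X (T t) - y).
  by rewrite -yE opprB addrA subrK.
rewrite (le_trans (ler_normB _ _))// lerD2r mulrC; exact: bL.
Qed.

End UnstableGame.

(** At s = 0 the condition reduces to c'(0) >= 0, so a violation occurs at a
    positive load. *)
Lemma unstable_outside_Q (R : realType) (n : nat) (c : R -> R) :
  (2 <= n)%N -> class_D c -> ~ @class_Q R n c ->
  exists (eta : R) (G : game R n n) (xs : 'M[R]_n) (eps : R),
  [/\ 0 < eta, (forall e, exists b, cost G e = fun x => 1 * c x + b),
      reg_equilibria G eta xs, 0 < eps &
      forall delta, 0 < delta -> exists x : R -> 'M[R]_n,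
        [/\ FW_solution G eta x, enorm (x 0 - xs) <= delta &
            exists2 t, 0 <= t & forall y, reg_equilibria G eta y ->
              eps <= `|x t - y|]].
Proof.
move=> n2 cD cQ.
have [s [s_ge0 bad]] : exists s, 0 <= s /\
    gamma_n R n * drv c s - s * drv (drv c) s < 0.
  apply: contrapT => H; apply: cQ; split=> // x x0; rewrite leNgt; apply/negP => bad.
  by apply: H; exists x.
have N0 : 0 < n%:R - 1 :> R by rewrite subr_gt0 ltr1n.
have g0 : 0 <= gamma_n R n.
  by rewrite /gamma_n divr_ge0 ?(ltW N0)//.
have A0 : 0 <= drv c s by have [_ /(_ s s_ge0)[]] := cD.
have s0 : 0 < s.
  rewrite lt_neqAle s_ge0 andbT; apply/eqP => s0.
  move: bad; apply/negP; rewrite -leNgt -{2}s0 mul0r subr0.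
  exact: mulr_ge0.
have [p [q [a [p0 q0 a0 pqs slope]]]] := violation_split N0 g0 A0 s0 bad.
exact: line_game_unstable n2 cD p0 q0 a0 pqs slope.
Qed.

(** * The characterization *)

Section Characterization.
Variables (R : realType) (n : nat).
Hypothesis n2 : (2 <= n)%N.
Implicit Types C : set (R -> R).

Lemma sub_Q_locally_stable C : C `<=` @class_Q R n -> univ_locally_FW_stable n C.
Proof.
move=> CQ eta eta0 m G GC xs; apply: Q_locally_stable => // e; exact/CQ/GC.
Qed.

Lemma sub_Q_globally_stable C : C `<=` @class_Q R n -> univ_globally_FW_stable n C.
Proof.
by move=> CQ eta eta0 m G GC; apply: Q_globally_stable => // e; exact/CQ/GC.
Qed.

Lemma unstable_game_in C c : PAT_closed C -> C c -> ~ @class_Q R n c ->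
  exists (eta : R) (G : game R n n) (xs : 'M[R]_n) (eps : R),
  [/\ 0 < eta, (forall e, C (cost G e)), reg_equilibria G eta xs, 0 < eps &
      forall delta, 0 < delta -> exists x : R -> 'M[R]_n,
        [/\ FW_solution G eta x, enorm (x 0 - xs) <= delta &
            exists2 t, 0 <= t & forall y, reg_equilibria G eta y ->
              eps <= `|x t - y|]].
Proof.
move=> [CD Cpat] Cc cQ.
have [eta [G [xs [eps [eta0 Gc es eps0 H]]]]] := unstable_outside_Q n2 (CD _ Cc) cQ.
exists eta, G, xs, eps; split => // e.
by have [b ->] := Gc e; exact: Cpat.
Qed.

Lemma locally_stable_sub_Q C : PAT_closed C -> univ_locally_FW_stable n C ->
  C `<=` @class_Q R n.
Proof.
move=> patC stC c Cc; apply: contrapT => cQ.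
have [eta [G [xs [eps [eta0 GC es eps0 H]]]]] := unstable_game_in patC Cc cQ.
pose U := profiles G `&` [set y | `|xs - y| < eps].
have relU : rel_nbhs (profiles G) xs U.
  split=> [y []//|].
  suff : \forall y \near xs, profiles G y -> U y by [].
  have := nbhsx_ballx xs eps eps0; rewrite -ball_normE.
  by apply: filterS => y yb Ky; split.
have [V [[VK Vn] VU VP]] := stC eta eta0 n G GC xs es U relU.
have [d /= d0 dV] := (nbhs_ballP _ _).1 Vn.
have d2 : 0 < d / 2 by rewrite divr_gt0.
have [x [sx xd [t t0 /(_ xs es)]]] := H _ d2.
have [K0 _] := sx 0 (lexx _).
have V0 : V (x 0).
  apply: dV K0; rewrite -ball_normE /ball_/= distrC.
  apply: le_lt_trans (norm_le_enorm _) _; apply: le_lt_trans xd _.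
  by rewrite ltr_pdivrMr// ltr_pMr// ltr1n.
have := VP x sx V0 t t0.
by move=> [_ /= h] /(lt_le_trans h); rewrite distrC ltxx.
Qed.

Lemma globally_stable_sub_Q C : PAT_closed C -> univ_globally_FW_stable n C ->
  C `<=` @class_Q R n.
Proof.
move=> patC stC c Cc; apply: contrapT => cQ.
have [eta [G [xs [eps [eta0 GC es eps0 H]]]]] := unstable_game_in patC Cc cQ.
have [st _] := stC eta eta0 n G GC.
have e2 : 0 < eps / 2 by rewrite divr_gt0.
have [d d0 dP] := st _ e2.
have [x [sx xd [t t0 tP]]] := H d d0.
have : (edist_to (x 0%R) (reg_equilibria G eta) <= d%:E)%E.
  apply: le_trans (_ : (enorm (x 0 - xs))%:E <= _)%E; last by rewrite lee_fin.
  by apply: ereal_inf_lbound; exists xs.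
move=> /(dP x sx)/(_ t t0); apply/negP; rewrite -ltNge.
apply: (@lt_le_trans _ _ eps%:E).
  by rewrite lte_fin ltr_pdivrMr// ltr_pMr// ltr1n.
apply: le_ereal_inf_tmp => _ [y ey <-]; rewrite lee_fin.
exact: le_trans (tP y ey) (norm_le_enorm _).
Qed.

Lemma is_largest_unique (P : set (R -> R) -> Prop) (Q S : set (R -> R)) :
  is_largest P Q -> (is_largest P S <-> S = Q).
Proof.
move=> lQ; split=> [[PS Smax]|->//]; have [PQ Qmax] := lQ.
by apply/seteqP; split; [exact: Qmax | exact: Smax].
Qed.

End Characterization.

Theorem theorem2 (R : realType) (n : nat) (hn : (2 <= n)%N) :
  (forall C : set (R -> R), PAT_closed C ->
     (univ_locally_FW_stable n C <-> univ_globally_FW_stable n C) /\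
     (univ_globally_FW_stable n C <-> C `<=` @class_Q R n))
  /\
  [/\ PAT_closed (@class_Q R n),
      univ_locally_FW_stable n (@class_Q R n),
      univ_globally_FW_stable n (@class_Q R n) &
      forall C : set (R -> R), PAT_closed C ->
        univ_locally_FW_stable n C \/ univ_globally_FW_stable n C ->
        C `<=` @class_Q R n]
  /\
  (forall S : set (R -> R),
     (is_largest (fun C => PAT_closed C /\ univ_locally_FW_stable n C) S
        <-> S = @class_Q R n) /\
     (is_largest (fun C => PAT_closed C /\ univ_globally_FW_stable n C) S
        <-> S = @class_Q R n)).
Proof.
have lg C : PAT_closed C -> univ_globally_FW_stable n C <-> C `<=` @class_Q R n.
  move=> patC; split; first exact: globally_stable_sub_Q.
  exact: sub_Q_globally_stable.
have ll C : PAT_closed C -> univ_locally_FW_stable n C <-> C `<=` @class_Q R n.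
  move=> patC; split; first exact: locally_stable_sub_Q.
  exact: sub_Q_locally_stable.
have Qpat := @class_Q_PAT R n.
have Ql : univ_locally_FW_stable n (@class_Q R n) by exact/(ll _ Qpat).
have Qg : univ_globally_FW_stable n (@class_Q R n) by exact/(lg _ Qpat).
split.
  move=> C patC; split; last exact: lg.
  exact: iff_trans (ll C patC) (iff_sym (lg C patC)).
split.
  split=> // C patC [|]; first by move=> /(ll C patC).
  by move=> /(lg C patC).
move=> S; split; apply: is_largest_unique; split=> // C [patC].
  by move=> /(ll C patC).
by move=> /(lg C patC).
Qed.
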